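(* Let $g$ be a Riemannian metric on the generically transcendental quantum torus $A_\Theta$, and let $r,s\in\mathbb{R}_{>0}$. Let $F(w,x,y,z)=wz+xy$, $G(x,y,z)=(3x+y)z$ and $H(x,y)=2xy$ for $w,x,y,z\in[0,\infty)$, and put $$\Omega_r=(\chi_\Theta,\langle\cdot|\cdot\rangle_{r\cdot g},\mathsf{D}_{r\cdot g,\mathsf{M}},A_\Theta,\mathsf{L}),\qquad \Omega_s=(\chi_\Theta,\langle\cdot|\cdot\rangle_{s\cdot g},\mathsf{D}_{s\cdot g,\mathsf{M}},A_\Theta,\mathsf{L}).$$ Then the modular Gromov–Hausdorff propinquity satisfies $\Lambda^{\mathsf{mod}}_{F,G,H}(\Omega_r,\Omega_s)=0$.
   Context: **Torus.** Fix $n\in\mathbb{N}=\{1,2,\dots\}$, $[n]=\{1,\dots,n\}$, a real skew-symmetric $n\times n$ matrix $\Theta$ that is generically transcendental (see below), and an arbitrary norm $N$ on $\mathbb{R}^n$. $A_\Theta$ is the universal $C^*$-algebra generated by unitaries $u_1,\dots,u_n$ with $u_ku_j=e^{2\pi i\Theta_{jk}}u_ju_k$. The torus $\mathbb{T}^n=\mathbb{R}^n/\mathbb{Z}^n$ acts on $A_\Theta$ by $\alpha_{\bm{s}+\mathbb{Z}^n}(u_j)=e^{2\pi i s_j}u_j$; $A_\Theta^\infty$ is the $*$-algebra of smooth elements of $\alpha$, and $\partial_1,\dots,\partial_n$ are the coordinate directional derivatives of $\alpha$ on $A_\Theta^\infty$ (so $\partial_j(u_k)=2\pi i\,\delta_{jk}u_k$).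 $\tau$ is the faithful tracial state on $A_\Theta$ and $\mathrm{ad}_a(b)=ab-ba$. $\mathcal{D}_\Theta$ is the real vector space of $*$-derivations $A_\Theta^\infty\to A_\Theta^\infty$. ''Generically transcendental'' is a Diophantine condition on $\Theta$ of Bratteli–Elliott–Jorgensen, under which every $\delta\in\mathcal{D}_\Theta$ is uniquely of the form $\delta=\sum_{j=1}^n r_j\partial_j+\mathrm{ad}_a$ with $r_j\in\mathbb{R}$ and $a\in A_\Theta^\infty$ skew-adjoint with $\tau(a)=0$; this consequence is how the condition enters and may be taken as the hypothesis on $\Theta$. Put $\|\delta\|_{\mathcal{D}_\Theta}=N(r_1,\dots,r_n)+\|a\|_{A_\Theta}$. **Seminorm $\mathsf{L}$.** For $\bm{s}\in[-\frac12,\frac12)^n$ put $\ell(\bm{s}+\mathbb{Z}^n)=N(\bm{s})$. For self-adjoint $a\in A_\Theta$ let $\mathsf{L}(a)=\sup\{\|\alpha_{\bm{t}}(a)-a\|_{A_\Theta}/\ell(\bm{t}) : \bm{t}\in\mathbb{T}^n\setminus\{\bm{0}\}\}$, with $\mathrm{Dom}(\mathsf{L})$ the set of self-adjoint $a$ for which this is finite. **Modules and metrics.** $\chi_\Theta=A_\Theta^n$ is the free left $A_\Theta$-module with action $\bullet$ by left multiplication on components and standard basis $\mathbf{e}_1,\dots,\mathbf{e}_n$; $\chi_\Theta^\infty$ is the set of elements with all components in $A_\Theta^\infty$. $\langle\sum a_j\bullet\mathbf{e}_j|\sum b_j\bullet\mathbf{e}_j\rangle_{\mathrm{st}}=\sum_j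 a_jb_j^*$. For $g\in M_n(A_\Theta)$, $T_g(\sum_j a_j\bullet\mathbf{e}_j)=\sum_k(\sum_j a_jg_{jk})\bullet\mathbf{e}_k$. A Riemannian metric is a positive invertible $g\in M_n(A_\Theta)$ all of whose entries are self-adjoint elements of $A_\Theta^\infty$. Put $\langle X|Y\rangle_g=\langle T_g(X)|Y\rangle_{\mathrm{st}}$ and $\|X\|_g=\|\langle X|X\rangle_g\|_{A_\Theta}^{1/2}$. **Levi-Civita connection.** For a Riemannian metric $g$, by a theorem of Rosenberg there is a unique map $\nabla^g:\mathcal{D}_\Theta\times\chi_\Theta^\infty\to\chi_\Theta^\infty$ such that: (1) it is $\mathbb{R}$-linear in the first and $\mathbb{C}$-linear in the second variable; (2) $\nabla^g_\delta(a\bullet X)=\delta(a)\bullet X+a\bullet\nabla^g_\delta(X)$ for $a\in A_\Theta^\infty$; (3) $\nabla^g_{\mathrm{ad}_a}(X)=a\bullet X$ for skew-adjoint $a\in A_\Theta^\infty$ with $\tau(a)=0$; (4) $\langle\nabla^g_{\partial_j}(\mathbf{e}_k)|\mathbf{e}_l\rangle_g$ is self-adjoint for all $j,k,l\in[n]$; (5) $\nabla^g_{\partial_j}(\mathbf{e}_k)=\nabla^g_{\partial_k}(\mathbf{e}_j)$ for all $j,k$; (6) $\delta(\langle X|Y\rangle_g)=\langle\nabla^g_\delta(X)|Y\rangle_g+\langle X|\nabla^g_\delta(Y)\rangle_g$ for all $\delta\in\mathcal{D}_\Theta$, $X,Y\in\chi_\Theta^\infty$. **Norms $\mathsf{D}_g$,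 $\mathsf{D}_{g,\mathsf{M}}$.** On $\chi_\Theta^\infty$ let $|||X|||_g=\sup\{\|\nabla^g_\delta(X)\|_g:\delta\in\mathcal{D}_\Theta,\ \|\delta\|_{\mathcal{D}_\Theta}\le1\}$ and $\mathsf{D}_g=\max(\|\cdot\|_g,|||\cdot|||_g)$. For a (semi)norm $L$ on a domain, $L^r=\{v\in\mathrm{Dom}(L):L(v)\le r\}$. $\mathsf{D}_{g,\mathsf{M}}$ is the Minkowski gauge functional of $C=\overline{\mathsf{D}_g^1}^{\|\cdot\|_g}\subseteq\chi_\Theta$: $\mathrm{Dom}(\mathsf{D}_{g,\mathsf{M}})=\{X\in\chi_\Theta:\exists r>0,\ X\in r\cdot C\}$ and $\mathsf{D}_{g,\mathsf{M}}(X)=\inf\{r>0:X\in r\cdot C\}$. **Quantum compact metric spaces.** An admissible function is $F:[0,\infty)^4\to[0,\infty)$, non-decreasing in each argument, with $wz+xy\le F(w,x,y,z)$. An $F$-quasi-Leibniz quantum compact metric space is a pair $(A,\mathsf{L})$ with: (1) $A$ a unital $C^*$-algebra; (2) $\mathsf{L}$ a seminorm defined on a dense Jordan–Lie subalgebra of the self-adjoint part of $A$; (3) $\{a\in\mathrm{Dom}(\mathsf{L}):\mathsf{L}(a)=0\}=\mathbb{R}\cdot1_A$; (4) $\mathsf{mk}_{\mathsf{L}}(\phi,\psi)=\sup\{|\phi(a)-\psi(a)|:a\in\mathsf{L}^1\}$ metrizes the weak-$*$ topology of the state space $\mathscr{S}(A)$; (5) $\mathsf{L}^1$ is norm-closed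 in $A$; (6) $\max(\mathsf{L}(\frac12(ab+ba)),\mathsf{L}(\frac1{2i}(ab-ba)))\le F(\|a\|,\|b\|,\mathsf{L}(a),\mathsf{L}(b))$ for $a,b\in\mathrm{Dom}(\mathsf{L})$. **Metrized quantum vector bundles.** An admissible triple $(F,G,H)$ consists of an admissible $F$ and functions $G:[0,\infty)^3\to[0,\infty)$, $H:[0,\infty)^2\to[0,\infty)$, non-decreasing in each argument, with $(x+y)z\le G(x,y,z)$ and $2xy\le H(x,y)$. An $(F,G,H)$-metrized quantum vector bundle is a tuple $(\mathsf{X},\langle\cdot|\cdot\rangle,\mathsf{D},A,\mathsf{L})$ with: (1) $(A,\mathsf{L})$ an $F$-quasi-Leibniz quantum compact metric space; (2) $(\mathsf{X},\langle\cdot|\cdot\rangle)$ a left Hilbert $A$-module, with norm $\|\cdot\|_{\mathsf{X}}$; (3) $\mathsf{D}$ a norm on a $\|\cdot\|_{\mathsf{X}}$-dense $\mathbb{C}$-linear subspace of $\mathsf{X}$; (4) $\|\zeta\|_{\mathsf{X}}\le\mathsf{D}(\zeta)$ on $\mathrm{Dom}(\mathsf{D})$; (5) $\mathsf{D}^1$ is $\|\cdot\|_{\mathsf{X}}$-compact; (6) for $a\in\mathrm{Dom}(\mathsf{L})$, $\zeta\in\mathrm{Dom}(\mathsf{D})$: $a\bullet\zeta\in\mathrm{Dom}(\mathsf{D})$ and $\mathsf{D}(a\bullet\zeta)\le G(\|a\|_A,\mathsf{L}(a),\mathsf{D}(\zeta))$; (7) for $\zeta,\eta\in\mathrm{Dom}(\mathsf{D})$: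 $\Re\langle\zeta|\eta\rangle,\Im\langle\zeta|\eta\rangle\in\mathrm{Dom}(\mathsf{L})$ and $\max(\mathsf{L}(\Re\langle\zeta|\eta\rangle),\mathsf{L}(\Im\langle\zeta|\eta\rangle))\le H(\mathsf{D}(\zeta),\mathsf{D}(\eta))$. Here $\Re b=\frac12(b+b^* )$, $\Im b=\frac1{2i}(b-b^* )$. For the functions $F,G,H$ of the claim, the tuples $\Omega_r$ and $\Omega_s$ are $(F,G,H)$-metrized quantum vector bundles. **Modular bridges.** For a unital $C^*$-algebra $B$ and self-adjoint $\mathfrak{b}\in B$, let $\mathscr{S}(B|\mathfrak{b})$ be the set of states $\phi$ of $B$ with $\phi((1_B-\mathfrak{b})^*(1_B-\mathfrak{b}))=0=\phi((1_B-\mathfrak{b})(1_B-\mathfrak{b})^* )$. An $(F,G,H)$-modular bridge is a tuple $\gamma=(\Omega_1,\Omega_2,B,\mathfrak{b},\pi_1,\pi_2,\mathcal{N},\sigma,\beta)$ where $\Omega_i=(\mathsf{X}_i,\langle\cdot|\cdot\rangle_i,\mathsf{D}_i,A_i,\mathsf{L}_i)$ ($i=1,2$) are $(F,G,H)$-metrized quantum vector bundles, $B$ is a unital $C^*$-algebra, $\mathfrak{b}\in B$ is self-adjoint with $\mathscr{S}(B|\mathfrak{b})\ne\varnothing$ and $\|\mathfrak{b}\|_B=1$, $\pi_i:A_i\to B$ are unital $*$-monomorphisms, $\mathcal{N}$ is a non-empty set, and $\sigma:\mathcal{N}\to\mathsf{D}_1^1$, $\beta:\mathcal{N}\to\mathsf{D}_2^1$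 are functions. Write $\mathrm{Dom}(\gamma)=\Omega_1$, $\mathrm{Co\text{-}Dom}(\gamma)=\Omega_2$. For a metrized quantum vector bundle $\Omega=(\mathsf{X},\langle\cdot|\cdot\rangle,\mathsf{D},A,\mathsf{L})$ put $\mathsf{k}_\Omega(\zeta,\eta)=\sup\{\|\langle\zeta-\eta|\theta\rangle\|_A:\theta\in\mathsf{D}^1\}$, a metric on $\mathsf{X}$. Let $\mathsf{Haus}_d$ denote the Hausdorff distance induced by $d$. Associated with $\gamma$: - bridge seminorm: $\mathsf{bn}_\gamma(a_1,a_2)=\|\pi_1(a_1)\mathfrak{b}-\mathfrak{b}\pi_2(a_2)\|_B$ for $a_i\in A_i$; - basic reach: $\rho_\flat(\gamma)=\max\big(\sup_{a_1\in\mathsf{L}_1^1}\inf_{a_2\in\mathsf{L}_2^1}\mathsf{bn}_\gamma(a_1,a_2),\ \sup_{a_2\in\mathsf{L}_2^1}\inf_{a_1\in\mathsf{L}_1^1}\mathsf{bn}_\gamma(a_1,a_2)\big)$; - height: $\varsigma(\gamma)=\max_{i=1,2}\mathsf{Haus}_{\mathsf{mk}_{\mathsf{L}_i}}\big(\mathscr{S}(A_i),\{\phi\circ\pi_i:\phi\in\mathscr{S}(B|\mathfrak{b})\}\big)$; - deck seminorm on $\mathsf{X}_1\oplus\mathsf{X}_2$: $\mathsf{dn}_\gamma(\zeta,\eta)=\sup_{\nu\in\mathcal{N}}\max\big(\mathsf{bn}_\gamma(\langle\zeta|\sigma(\nu)\rangle_1,\langle\eta|\beta(\nu)\rangle_2),\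 \mathsf{bn}_\gamma(\langle\sigma(\nu)|\zeta\rangle_1,\langle\beta(\nu)|\eta\rangle_2)\big)$; - modular reach: $\rho^\sharp(\gamma)=\sup_{\nu\in\mathcal{N}}\mathsf{dn}_\gamma(\sigma(\nu),\beta(\nu))$; - imprint: $\varpi(\gamma)=\max\big(\mathsf{Haus}_{\mathsf{k}_{\Omega_1}}(\mathrm{Range}(\sigma),\mathsf{D}_1^1),\ \mathsf{Haus}_{\mathsf{k}_{\Omega_2}}(\mathrm{Range}(\beta),\mathsf{D}_2^1)\big)$; - reach: $\rho(\gamma)=\max(\rho_\flat(\gamma),\rho^\sharp(\gamma)+\varpi(\gamma))$; - length: $\lambda(\gamma)=\max(\varsigma(\gamma),\rho(\gamma))$. **Modular Gromov–Hausdorff propinquity.** For $(F,G,H)$-metrized quantum vector bundles $\Omega_1,\Omega_2$, $\Lambda^{\mathsf{mod}}_{F,G,H}(\Omega_1,\Omega_2)$ is the infimum of $\sum_{j=1}^m\lambda(\gamma_j)$ over all finite sequences $\gamma_1,\dots,\gamma_m$ of $(F,G,H)$-modular bridges with $\mathrm{Dom}(\gamma_1)=\Omega_1$, $\mathrm{Co\text{-}Dom}(\gamma_m)=\Omega_2$ and $\mathrm{Dom}(\gamma_{j+1})=\mathrm{Co\text{-}Dom}(\gamma_j)$ for $1\le j\le m-1$. *)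

(* Defs.v *)
From HB Require Import structures.
From mathcomp Require Import all_boot all_order all_algebra.
From mathcomp Require Import complex.
From mathcomp Require Import all_classical all_reals all_analysis.

Set Implicit Arguments.
Unset Strict Implicit.
Unset Printing Implicit Defensive.

Import Order.TTheory GRing.Theory Num.Theory numFieldNormedType.Exports.

Local Open Scope classical_set_scope.
Local Open Scope ring_scope.
Local Open Scope complex_scope.

(* The norm of [R[i]] takes its (real) values in [R[i]]. *)
Definition cabs (R : realType) (c : R[i]) : R := complex.Re `|c|.

(* [exp (2 * pi * i * x)] *)
Definition expi2pi (R : realType) (x : R) : R[i] :=
  cos (2 * pi * x) +i* sin (2 * pi * x).

(* The norms on modules below depend on parameters, so they are not attached to
   the carrier type. [norm_closure] and [norm_compact] are the library's
   [closure] and [compact] for the neighbourhood filters [norm_nbhs nu]. *)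
Section NormTopology.
Context {R : realType} {V : zmodType}.
Implicit Types (nu : V -> R) (S : set V).

Definition norm_nbhs nu (x : V) : set_system V :=
  filter_from [set e : R | 0 < e] (fun e => [set y | nu (x - y) < e]).

Definition norm_closure nu S : set V :=
  [set x | forall B, norm_nbhs nu x B -> S `&` B !=set0].

Definition norm_compact nu S : Prop :=
  forall F : set_system V, ProperFilter F -> F S ->
    S `&` [set x | F `#` norm_nbhs nu x] !=set0.

Definition norm_complete nu : Prop :=
  forall x : nat -> V,
    (forall e, 0 < e -> exists k : nat, forall i j : nat,
      (k <= i)%N -> (k <= j)%N -> nu (x i - x j) < e) ->
    exists l : V, forall e, 0 < e -> exists k : nat, forall i : nat,
      (k <= i)%N -> nu (x i - l) < e.

End NormTopology.

(* [algType] is the class of algebras with [1 != 0]: the zero algebra is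
   excluded. It has no state, and it is irrelevant to universal properties. *)
HB.mixin Record isCstarAlgebra (R : realType) A of GRing.Algebra R[i] A := {
  star : A -> A;
  cnorm : A -> R;
  starD : forall a b, star (a + b) = star a + star b;
  starZ : forall (c : R[i]) a, star (c *: a) = c^* *: star a;
  starM : forall a b, star (a * b) = star b * star a;
  starK : forall a, star (star a) = a;
  cnormD : forall a b, cnorm (a + b) <= cnorm a + cnorm b;
  cnormZ : forall (c : R[i]) a, cnorm (c *: a) = cabs c * cnorm a;
  cnorm0_eq0 : forall a, cnorm a = 0 -> a = 0;
  cnormM : forall a b, cnorm (a * b) <= cnorm a * cnorm b;
  cnorm_star_mul : forall a, cnorm (star a * a) = cnorm a ^+ 2;
  cnorm_complete : norm_complete cnorm
}.

#[short(type="cstarType")]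
HB.structure Definition CstarAlgebra (R : realType) :=
  {A of isCstarAlgebra R A & GRing.Algebra R[i] A}.

(* The real normed space underlying a C*-algebra: it gives access to the
   library's topology and derivatives. *)
Definition realified (A : Type) : Type := A.

Section Realified.
Context {R : realType} (A : cstarType R).

HB.instance Definition _ := GRing.Zmodule.on (realified A).

Let rscale (c : R) (a : realified A) : realified A := (c%:C *: (a : A)).

Let rscaleA c d a : rscale c (rscale d a) = rscale (c * d) a.
Proof. by rewrite /rscale scalerA -rmorphM. Qed.
Let rscale1 : left_id 1 rscale.
Proof. by move=> a; rewrite /rscale scale1r. Qed.
Let rscaleDr : right_distributive rscale +%R.
Proof. by move=> c a b; rewrite /rscale scalerDr. Qed.
Let rscaleDl a : {morph rscale^~ a : c d / c + d}.
Proof. by move=> c d; rewrite /rscale rmorphD scalerDl. Qed.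

HB.instance Definition _ := GRing.Zmodule_isLmodule.Build R (realified A)
  rscaleA rscale1 rscaleDr rscaleDl.

Let rnorm (a : realified A) : R := cnorm (a : A).

Let rnormD a b : rnorm (a + b) <= rnorm a + rnorm b.
Proof. exact: cnormD. Qed.
Let rnormZ (c : R) a : rnorm (c *: a) = `|c| * rnorm a.
Proof. by rewrite /rnorm [LHS]cnormZ /cabs normc_def /= expr0n addr0 sqrtr_sqr. Qed.
Let rnorm0_eq0 a : rnorm a = 0 -> a = 0.
Proof. exact: cnorm0_eq0. Qed.

HB.instance Definition _ := Lmodule_isNormed.Build R (realified A)
  rnormD rnormZ rnorm0_eq0.

End Realified.

Section CstarTheory.
Context {R : realType}.
Implicit Types A B : cstarType R.

Definition selfadjoint A (a : A) : Prop := star a = a.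
Definition skewadjoint A (a : A) : Prop := star a = - a.
Definition positive A (a : A) : Prop := exists b : A, a = star b * b.

Definition re_part A (a : A) : A := (2^-1 : R[i]) *: (a + star a).
Definition im_part A (a : A) : A := ((2 * 'i)^-1 : R[i]) *: (a - star a).
Definition jordan A (a b : A) : A := (2^-1 : R[i]) *: (a * b + b * a).
Definition lie A (a b : A) : A := ((2 * 'i)^-1 : R[i]) *: (a * b - b * a).

Definition star_preserving A B (f : A -> B) : Prop :=
  forall a, f (star a) = star (f a).

Definition unitary A (v : A) : Prop := star v * v = 1 /\ v * star v = 1.

Definition state A : set (A -> R[i]) := [set phi |
  [/\ forall (c : R[i]) a b, phi (c *: a + b) = c * phi a + phi b,
      forall a, 0 <= phi (star a * a) & phi 1 = 1]].

Definition tracial A (phi : A -> R[i]) : Prop :=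
  forall a b, phi (a * b) = phi (b * a).
Definition faithful A (phi : A -> R[i]) : Prop :=
  forall a, phi (star a * a) = 0 -> a = 0.

Definition state_level B (b : B) : set (B -> R[i]) :=
  [set phi | [/\ state phi, phi (star (1 - b) * (1 - b)) = 0 &
                phi ((1 - b) * star (1 - b)) = 0]].

(* The complex vector space structure of a module over a unital algebra. *)
Definition complex_scale A (X : lmodType A) (c : R[i]) (x : X) : X := c%:A *: x.

End CstarTheory.

Definition Haus (R : realType) (T : Type) (d : T -> T -> \bar R)
    (S S' : set T) : \bar R :=
  maxe (ereal_sup [set ereal_inf [set d x y | y in S'] | x in S])
       (ereal_sup [set ereal_inf [set d x y | x in S] | y in S']).

(* A (semi)norm on a domain is a function to [\bar R] with value [+oo] exactly
   outside of its domain. *)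
Definition dom (R : realType) (T : Type) (L : T -> \bar R) : set T :=
  [set x | (L x < +oo)%E].
Definition unit_ball (R : realType) (T : Type) (L : T -> \bar R) : set T :=
  [set x | (L x <= 1)%E].

Definition mk (R : realType) (A : cstarType R) (L : A -> \bar R)
    (phi psi : A -> R[i]) : \bar R :=
  ereal_sup [set (cabs (phi a - psi a))%:E | a in unit_ball L].

Definition admissible (R : realType) (F : R -> R -> R -> R -> R) : Prop :=
  [/\ forall w x y z, 0 <= w -> 0 <= x -> 0 <= y -> 0 <= z ->
        w * z + x * y <= F w x y z,
      forall w x y z, 0 <= w -> 0 <= x -> 0 <= y -> 0 <= z -> 0 <= F w x y z &
      forall w x y z w' x' y' z', 0 <= w -> 0 <= x -> 0 <= y -> 0 <= z ->
        w <= w' -> x <= x' -> y <= y' -> z <= z' -> F w x y z <= F w' x' y' z'].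

Record admissible_triple (R : realType) := AdmissibleTriple {
  tF : R -> R -> R -> R -> R;
  tG : R -> R -> R -> R;
  tH : R -> R -> R;
  tF_admissible : admissible tF;
  tG_ge0 : forall x y z, 0 <= x -> 0 <= y -> 0 <= z -> 0 <= tG x y z;
  tG_homo : forall x y z x' y' z', 0 <= x -> 0 <= y -> 0 <= z ->
    x <= x' -> y <= y' -> z <= z' -> tG x y z <= tG x' y' z';
  tG_ge : forall x y z, 0 <= x -> 0 <= y -> 0 <= z -> (x + y) * z <= tG x y z;
  tH_ge0 : forall x y, 0 <= x -> 0 <= y -> 0 <= tH x y;
  tH_homo : forall x y x' y', 0 <= x -> 0 <= y ->
    x <= x' -> y <= y' -> tH x y <= tH x' y';
  tH_ge : forall x y, 0 <= x -> 0 <= y -> 2 * x * y <= tH x y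
}.

Record is_qcms (R : realType) (F : R -> R -> R -> R -> R) (A : cstarType R)
    (L : A -> \bar R) : Prop := IsQcms {
  qcms_sa : forall a, dom L a -> selfadjoint a;
  qcms_dom0 : dom L 0;
  qcms_domD : forall a b, dom L a -> dom L b -> dom L (a + b);
  qcms_domZ : forall (c : R) a, dom L a -> dom L (c%:C *: a);
  qcms_domJ : forall a b, dom L a -> dom L b -> dom L (jordan a b);
  qcms_domL : forall a b, dom L a -> dom L b -> dom L (lie a b);
  qcms_dense : [set a : realified A | selfadjoint (a : A)] `<=`
    closure (dom L : set (realified A));
  qcms_ge0 : forall a, (0 <= L a)%E;
  qcms_seminormD : forall a b, dom L a -> dom L b -> (L (a + b)%R <= L a + L b)%E;
  qcms_seminormZ : forall (c : R) a, dom L a -> L (c%:C *: a) = (`|c|%:E * L a)%E;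
  qcms_ker : [set a | L a = 0%E] = [set (c%:C *: 1) | c in [set: R]];
  qcms_mk_fin : forall phi psi, state phi -> state psi ->
    mk L phi psi \is a fin_num;
  (* the neighbourhoods of [phi] in the weak-* topology of the state space are
     those of the metric *)
  qcms_mk_weak : forall phi, state phi -> forall U : set (A -> R[i]),
    within (@state R A) (nbhs (phi : {ptws A -> R[i]^o})) U <->
    exists2 e : R, 0 < e &
      [set psi | state psi /\ (mk L phi psi < e%:E)%E] `<=` U;
  qcms_closed : closed (unit_ball L : set (realified A));
  qcms_leibniz : forall a b, dom L a -> dom L b ->
    (maxe (L (jordan a b)) (L (lie a b)) <=
     (F (cnorm a) (cnorm b) (fine (L a)) (fine (L b)))%:E)%E
}.

Definition hnorm (R : realType) (A : cstarType R) (X : Type) (ip : X -> X -> A)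
  (x : X) : R := Num.sqrt (cnorm (ip x x)).

Record is_hilbert_module (R : realType) (A : cstarType R) (X : lmodType A)
    (ip : X -> X -> A) : Prop := IsHilbertModule {
  hm_linear : forall a x y z, ip (a *: x + y) z = a * ip x z + ip y z;
  hm_star : forall x y, star (ip x y) = ip y x;
  hm_positive : forall x, positive (ip x x);
  hm_definite : forall x, ip x x = 0 -> x = 0;
  hm_complete : norm_complete (hnorm ip)
}.

Record bundle (R : realType) := Bundle {
  b_alg : cstarType R;
  b_L : b_alg -> \bar R;
  b_mod : lmodType b_alg;
  b_ip : b_mod -> b_mod -> b_alg;
  b_D : b_mod -> \bar R
}.

Arguments b_L [R] b _.
Arguments b_ip [R] b _ _.
Arguments b_D [R] b _.

Record is_mqvb (R : realType) (t : admissible_triple R) (O : bundle R) : Prop :=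
  IsMqvb {
  mqvb_qcms : is_qcms (tF t) (b_L O);
  mqvb_hilbert : is_hilbert_module (b_ip O);
  mqvb_dom0 : dom (b_D O) 0;
  mqvb_domD : forall x y, dom (b_D O) x -> dom (b_D O) y ->
    dom (b_D O) (x + y);
  mqvb_domZ : forall (c : R[i]) x, dom (b_D O) x -> dom (b_D O) (complex_scale c x);
  mqvb_dense : norm_closure (hnorm (b_ip O)) (dom (b_D O)) = setT;
  mqvb_ge0 : forall x, (0 <= b_D O x)%E;
  mqvb_normD : forall x y, dom (b_D O) x -> dom (b_D O) y ->
    (b_D O (x + y)%R <= b_D O x + b_D O y)%E;
  mqvb_normZ : forall (c : R[i]) x, dom (b_D O) x ->
    b_D O (complex_scale c x) = ((cabs c)%:E * b_D O x)%E;
  mqvb_norm0 : forall x, b_D O x = 0%E -> x = 0;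
  mqvb_ge : forall x, dom (b_D O) x -> ((hnorm (b_ip O) x)%:E <= b_D O x)%E;
  mqvb_compact : norm_compact (hnorm (b_ip O)) (unit_ball (b_D O));
  mqvb_modular : forall a x, dom (b_L O) a -> dom (b_D O) x ->
    dom (b_D O) (a *: x) /\
    (b_D O (a *: x)%R <= (tG t (cnorm a) (fine (b_L O a)) (fine (b_D O x)))%:E)%E;
  mqvb_inner : forall x y, dom (b_D O) x -> dom (b_D O) y ->
    [/\ dom (b_L O) (re_part (b_ip O x y)), dom (b_L O) (im_part (b_ip O x y)) &
      (maxe (b_L O (re_part (b_ip O x y))) (b_L O (im_part (b_ip O x y))) <=
       (tH t (fine (b_D O x)) (fine (b_D O y)))%:E)%E]
}.

Definition kdist (R : realType) (O : bundle R) (x y : b_mod O) : \bar R :=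
  ereal_sup [set (cnorm (b_ip O (x - y) w))%:E | w in unit_ball (b_D O)].

Record modular_bridge (R : realType) (t : admissible_triple R) := ModularBridge {
  br_dom : bundle R;
  br_cod : bundle R;
  br_dom_mqvb : is_mqvb t br_dom;
  br_cod_mqvb : is_mqvb t br_cod;
  br_alg : cstarType R;
  br_pivot : br_alg;
  br_pivot_sa : selfadjoint br_pivot;
  br_pivot_level : state_level br_pivot !=set0;
  br_pivot_norm : cnorm br_pivot = 1;
  br_pi1 : {lrmorphism b_alg br_dom -> br_alg};
  br_pi2 : {lrmorphism b_alg br_cod -> br_alg};
  br_pi1_star : star_preserving br_pi1;
  br_pi2_star : star_preserving br_pi2;
  br_pi1_inj : injective br_pi1;
  br_pi2_inj : injective br_pi2;
  br_index : Type;
  br_index_inhabited : inhabited br_index;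
  br_anchor : br_index -> b_mod br_dom;
  br_coanchor : br_index -> b_mod br_cod;
  br_anchor_ball : forall nu, unit_ball (b_D br_dom) (br_anchor nu);
  br_coanchor_ball : forall nu, unit_ball (b_D br_cod) (br_coanchor nu)
}.

Section BridgeLength.
Context {R : realType} {t : admissible_triple R} (g : modular_bridge t).
Local Open Scope ereal_scope.

Definition bridge_seminorm (a1 : b_alg (br_dom g)) (a2 : b_alg (br_cod g)) :
    \bar R :=
  (cnorm (br_pi1 g a1 * br_pivot g - br_pivot g * br_pi2 g a2)%R)%:E.

Definition basic_reach : \bar R :=
  let B1 := unit_ball (b_L (br_dom g)) in
  let B2 := unit_ball (b_L (br_cod g)) in
  maxe
    (ereal_sup [set ereal_inf [set bridge_seminorm a1 a2 | a2 in B2] | a1 in B1])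
    (ereal_sup [set ereal_inf [set bridge_seminorm a1 a2 | a1 in B1] | a2 in B2]).

Definition bridge_height : \bar R :=
  maxe
    (Haus (mk (b_L (br_dom g))) (@state R (b_alg (br_dom g)))
      [set phi \o br_pi1 g | phi in state_level (br_pivot g)])
    (Haus (mk (b_L (br_cod g))) (@state R (b_alg (br_cod g)))
      [set phi \o br_pi2 g | phi in state_level (br_pivot g)]).

Definition deck_seminorm (x : b_mod (br_dom g)) (y : b_mod (br_cod g)) : \bar R :=
  ereal_sup (range (fun nu : br_index g =>
    maxe (bridge_seminorm (b_ip (br_dom g) x (br_anchor nu)) (b_ip (br_cod g) y (br_coanchor nu)))
         (bridge_seminorm (b_ip (br_dom g) (br_anchor nu) x) (b_ip (br_cod g) (br_coanchor nu) y)))).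

Definition modular_reach : \bar R :=
  ereal_sup (range (fun nu : br_index g =>
    deck_seminorm (br_anchor nu) (br_coanchor nu))).

Definition imprint : \bar R :=
  maxe
    (Haus (@kdist R (br_dom g)) (range (@br_anchor R t g))
      (unit_ball (b_D (br_dom g))))
    (Haus (@kdist R (br_cod g)) (range (@br_coanchor R t g))
      (unit_ball (b_D (br_cod g)))).

Definition reach : \bar R := maxe basic_reach (modular_reach + imprint).

Definition bridge_length : \bar R := maxe bridge_height reach.

End BridgeLength.

Definition propinquity (R : realType) (t : admissible_triple R)
    (O1 O2 : bundle R) : \bar R :=
  ereal_inf [set l | exists (m : nat) (g : 'I_m.+1 -> modular_bridge t),
    [/\ br_dom (g ord0) = O1, br_cod (g ord_max) = O2,
        forall j : 'I_m,
          br_dom (g (lift ord0 j)) = br_cod (g (widen_ord (leqnSn m) j)) &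
        l = (\sum_(j < m.+1) bridge_length (g j))%E]].

Definition is_norm (R : realType) (n : nat) (N : 'rV[R]_n -> R) : Prop :=
  [/\ forall x y, N (x + y) <= N x + N y,
      forall (c : R) x, N (c *: x) = `|c| * N x &
      forall x, N x = 0 -> x = 0].

Definition rotation_relations (R : realType) (n : nat) (Theta : 'M[R]_n)
    (B : cstarType R) (v : 'I_n -> B) : Prop :=
  (forall j, unitary (v j)) /\
  (forall j k, v k * v j = expi2pi (Theta j k) *: (v j * v k)).

Definition is_quantum_torus (R : realType) (n : nat) (Theta : 'M[R]_n)
    (A : cstarType R) (u : 'I_n -> A) : Prop :=
  rotation_relations Theta u /\
  forall (B : cstarType R) (v : 'I_n -> B), rotation_relations Theta v ->
    exists f : {lrmorphism A -> B},
      (star_preserving f /\ forall j, f (u j) = v j) /\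
      forall f' : {lrmorphism A -> B},
        star_preserving f' -> (forall j, f' (u j) = v j) -> f' =1 f.

(* The action of [R^n / Z^n] is indexed by representatives in [R^n]. *)
Definition is_torus_action (R : realType) (n : nat) (A : cstarType R)
    (u : 'I_n -> A) (alpha : 'rV[R]_n -> {lrmorphism A -> A}) : Prop :=
  forall s, star_preserving (alpha s) /\
    forall j, alpha s (u j) = expi2pi (s 0 j) *: u j.

Fixpoint class_C (R : realType) (n : nat) (V : normedModType R) (k : nat)
    (f : 'rV[R]_n -> V) : Prop :=
  continuous f /\
  if k is k'.+1 then
    forall j : 'I_n, (forall x, derivable f x (delta_mx 0 j)) /\
                     class_C k' ('D_(delta_mx 0 j) f)
  else True.

Section QuantumTorus.
Context {R : realType} {n : nat} {A : cstarType R}.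
Variables (alpha : 'rV[R]_n -> {lrmorphism A -> A}) (N : 'rV[R]_n -> R)
  (tau : A -> R[i]).

Definition orbit_map (a : A) : 'rV[R]_n -> realified A := fun t => alpha t a.

Definition smooth : set A := [set a | forall k, class_C k (orbit_map a)].

(* Maps from the smooth subalgebra to itself are represented by their extension
   by [0] to [A]; in this way equality of functions is the expected one. *)
Definition on_smooth (f : A -> A) : A -> A := patch (fun=> 0) smooth f.

Record derivation (delta : A -> A) : Prop := Derivation {
  der_out : forall a, ~ smooth a -> delta a = 0;
  der_smooth : forall a, smooth a -> smooth (delta a);
  der_linear : forall (c : R[i]) a b, smooth a -> smooth b ->
    delta (c *: a + b) = c *: delta a + delta b;
  der_leibniz : forall a b, smooth a -> smooth b ->
    delta (a * b) = delta a * b + a * delta b;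
  der_star : forall a, smooth a -> delta (star a) = star (delta a)
}.

Definition partial (j : 'I_n) : A -> A :=
  on_smooth (fun a => 'D_(delta_mx 0 j) (orbit_map a) 0).

Definition ad (a : A) : A -> A := on_smooth (fun b => a * b - b * a).

Definition decomposition (delta : A -> A) : set ('rV[R]_n * A) :=
  [set p : 'rV[R]_n * A | [/\ smooth p.2, skewadjoint p.2, tau p.2 = 0 &
    delta = \sum_(j < n) (p.1 0 j)%:C *: partial j + ad p.2]].

(* The consequence of the Diophantine condition on the matrix through which the
   condition is used. *)
Definition generically_transcendental : Prop :=
  forall delta, derivation delta -> exists! p, decomposition delta p.

Definition der_norm (delta : A -> A) : R :=
  let p := xget (0, 0) (decomposition delta) in N p.1 + cnorm p.2.

(* The nonzero points of [R^n / Z^n], through representatives *)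
Definition punctured_cube : set 'rV[R]_n :=
  [set t | t != 0 /\ forall j, - 2^-1 <= t 0 j < 2^-1].

Definition lip (a : A) : \bar R :=
  if `[< selfadjoint a >] then
    ereal_sup [set (cnorm (alpha t a - a) / N t)%:E | t in punctured_cube]
  else +oo%E.

Definition smooth_rv : set 'rV[A]_n := [set X | forall j, smooth (X 0 j)].

Definition basis_rv (k : 'I_n) : 'rV[A]_n := delta_mx 0 k.

Definition ip_st (X Y : 'rV[A]_n) : A := \sum_(j < n) X 0 j * star (Y 0 j).

Definition ip (g : 'M[A]_n) (X Y : 'rV[A]_n) : A := ip_st (X *m g) Y.

Definition adjoint_mx (g : 'M[A]_n) : 'M[A]_n := (map_mx (@star R A) g)^T.

Definition riemannian (g : 'M[A]_n) : Prop :=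
  [/\ exists h : 'M[A]_n, g = adjoint_mx h *m h,
      exists h : 'M[A]_n, g *m h = 1%:M /\ h *m g = 1%:M &
      forall j k, selfadjoint (g j k) /\ smooth (g j k)].

Record levi_civita (g : 'M[A]_n) (nabla : (A -> A) -> 'rV[A]_n -> 'rV[A]_n) :
    Prop := LeviCivita {
  lc_smooth : forall delta X, derivation delta -> smooth_rv X ->
    smooth_rv (nabla delta X);
  lc_linear1 : forall (c : R) delta delta' X,
    derivation delta -> derivation delta' -> smooth_rv X ->
    nabla (c%:C *: delta + delta') X =
    complex_scale c%:C (nabla delta X) + nabla delta' X;
  lc_linear2 : forall (c : R[i]) delta X Y,
    derivation delta -> smooth_rv X -> smooth_rv Y ->
    nabla delta (complex_scale c X + Y) = complex_scale c (nabla delta X) + nabla delta Y;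
  lc_leibniz : forall delta a X, derivation delta -> smooth a -> smooth_rv X ->
    nabla delta (a *: X) = delta a *: X + a *: nabla delta X;
  lc_ad : forall a X, smooth a -> skewadjoint a -> tau a = 0 -> smooth_rv X ->
    nabla (ad a) X = a *: X;
  lc_real : forall j k l,
    selfadjoint (ip g (nabla (partial j) (basis_rv k)) (basis_rv l));
  lc_torsion : forall j k,
    nabla (partial j) (basis_rv k) = nabla (partial k) (basis_rv j);
  lc_metric : forall delta X Y, derivation delta -> smooth_rv X -> smooth_rv Y ->
    delta (ip g X Y) = ip g (nabla delta X) Y + ip g X (nabla delta Y)
}.

Variables (g : 'M[A]_n) (nabla : (A -> A) -> 'rV[A]_n -> 'rV[A]_n).

Definition nabla_norm (X : 'rV[A]_n) : \bar R :=
  ereal_sup [set (hnorm (ip g) (nabla delta X))%:E |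
    delta in [set delta | derivation delta /\ der_norm delta <= 1]].

Definition D_norm (X : 'rV[A]_n) : \bar R :=
  if `[< smooth_rv X >] then maxe (hnorm (ip g) X)%:E (nabla_norm X) else +oo%E.

Definition D_minkowski (X : 'rV[A]_n) : \bar R :=
  ereal_inf [set r%:E | r in [set r : R | 0 < r /\
    exists2 Y, norm_closure (hnorm (ip g)) (unit_ball D_norm) Y &
               X = complex_scale r%:C Y]].

Definition torus_bundle : bundle R :=
  Bundle lip (ip g) D_minkowski.

End QuantumTorus.

Definition scale_metric (R : realType) (n : nat) (A : cstarType R) (r : R)
  (g : 'M[A]_n) : 'M[A]_n := map_mx (fun a => r%:C *: a) g.

Section TorusTriple.
Context (R : realType).

Definition torusF (w x y z : R) : R := w * z + x * y.
Definition torusG (x y z : R) : R := (3 * x + y) * z.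
Definition torusH (x y : R) : R := 2 * x * y.

Let F_adm : admissible torusF.
Proof.
split=> [//|w x y z w0 x0 y0 z0|w x y z w' x' y' z' w0 x0 y0 z0 ww xx yy zz].
  by rewrite addr_ge0 ?mulr_ge0.
by rewrite lerD ?ler_pM.
Qed.

Let G_ge0 x y z : 0 <= x -> 0 <= y -> 0 <= z -> 0 <= torusG x y z.
Proof. by move=> x0 y0 z0; rewrite mulr_ge0 ?addr_ge0 ?mulr_ge0. Qed.

Let G_homo x y z x' y' z' : 0 <= x -> 0 <= y -> 0 <= z ->
  x <= x' -> y <= y' -> z <= z' -> torusG x y z <= torusG x' y' z'.
Proof.
move=> x0 y0 z0 xx yy zz; rewrite ler_pM ?addr_ge0 ?mulr_ge0//.
by rewrite lerD// ler_wpM2l.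
Qed.

Let G_ge x y z : 0 <= x -> 0 <= y -> 0 <= z -> (x + y) * z <= torusG x y z.
Proof.
move=> x0 y0 z0; rewrite ler_wpM2r// lerD2r -[leLHS]mul1r ler_wpM2r//.
by rewrite ler1n.
Qed.

Let H_ge0 x y : 0 <= x -> 0 <= y -> 0 <= torusH x y.
Proof. by move=> x0 y0; rewrite !mulr_ge0. Qed.

Let H_homo x y x' y' : 0 <= x -> 0 <= y -> x <= x' -> y <= y' ->
  torusH x y <= torusH x' y'.
Proof. by move=> x0 y0 xx yy; rewrite ler_pM ?mulr_ge0// ler_wpM2l. Qed.

Let H_ge x y : 0 <= x -> 0 <= y -> 2 * x * y <= torusH x y.
Proof. by []. Qed.

Definition torus_triple : admissible_triple R :=
  AdmissibleTriple F_adm G_ge0 G_homo G_ge H_ge0 H_homo H_ge.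

End TorusTriple.

(* Main.v *)
Require Import Defs.
From HB Require Import structures.
From mathcomp Require Import all_boot all_order all_algebra.
From mathcomp Require Import complex ring lra.
From mathcomp Require Import all_classical all_reals all_analysis.
Set Implicit Arguments.
Unset Strict Implicit.
Unset Printing Implicit Defensive.
Import Order.TTheory GRing.Theory Num.Theory numFieldNormedType.Exports.
Local Open Scope classical_set_scope.
Local Open Scope ring_scope.
Local Open Scope complex_scope.

(** Let [c] be the square root of [r / s]. The multiplication by [c] maps the
    bundle of the metric [r * g] onto that of [s * g] and preserves the inner
    products, since [c * c * s = r]. It remains to see that it preserves the norms
    [D_minkowski] as well; then the two bundles are isometric over the identity
    of the algebra, and the bridge with the unit as pivot and corresponding
    anchors on both sides has length zero ([propinquity_isometry]).

    The norms are built from the connections, and a connection commutes with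
    complex scalars, so the point is that the connections of [r * g] and [s * g]
    coincide on derivations and smooth vectors. Both are Levi-Civita connections
    of [g] ([levi_civita_unscale]), and there is at most one such
    ([levi_civita_unique]) by Koszul's argument, run on the coordinate
    derivations and the basis of the free module, and extended by the Leibniz
    rule and the decomposition of derivations.

    Running that argument requires that the coordinate directional derivatives are
    derivations of the smooth subalgebra ([derivation_partial]). In particular
    they must preserve smoothness, which rests on the continuity of the
    automorphisms of the action. Continuity of *-morphisms is proved by
    an elementary route ([star_morphism_bounded]): a small self-adjoint element
    is the real part of a unitary, and *-morphisms preserve unitaries. *)

(** * Elementary facts on C*-algebras *)

Section Cstar.
Context {R : realType}.
Implicit Types A B : cstarType R.

Lemma star1 A : star (1 : A) = 1.
Proof. by rewrite -[LHS]mulr1 -[X in _ * X](starK (1 : A)) -starM mulr1 starK. Qed.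

Lemma starN A (a : A) : star (- a) = - star a.
Proof. by rewrite -scaleN1r starZ rmorphN rmorph1 scaleN1r. Qed.

Lemma star0 A : star (0 : A) = 0.
Proof. by rewrite -[in LHS](scale0r (0 : A)) starZ rmorph0 scale0r. Qed.

Lemma starZR A (c : R) (a : A) : star (c%:C *: a) = c%:C *: star a.
Proof. by rewrite starZ; congr (_ *: _); exact: conjc_real. Qed.

Lemma star_sum A (I : Type) (r : seq I) (f : I -> A) :
  star (\sum_(i <- r) f i) = \sum_(i <- r) star (f i).
Proof. exact: (big_morph _ (@starD R A) (star0 A)). Qed.

Lemma cnorm_ge0 A (a : A) : 0 <= cnorm a.
Proof. exact: (normr_ge0 (a : realified A)). Qed.

Lemma cnorm0 A : cnorm (0 : A) = 0.
Proof. exact: (normr0 (realified A)). Qed.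

Lemma cnormN A (a : A) : cnorm (- a) = cnorm a.
Proof. exact: (normrN (a : realified A)). Qed.

Lemma cabs_real (c : R) : cabs c%:C = `|c|.
Proof. by rewrite /cabs normc_def /= expr0n addr0 sqrtr_sqr. Qed.

Lemma cnorm_star A (a : A) : cnorm (star a) = cnorm a.
Proof.
have le_star (b : A) : cnorm b <= cnorm (star b).
  have := cnorm_ge0 b; rewrite le_eqVlt => /predU1P[<-|b0].
    exact: cnorm_ge0.
  by rewrite -(ler_pM2r b0) -expr2 -cnorm_star_mul cnormM.
by apply/eqP; rewrite eq_le le_star -{2}[a]starK le_star.
Qed.

Lemma cnorm1 A : cnorm (1 : A) = 1.
Proof.
have n0 : cnorm (1 : A) != 0.
  by apply/eqP => /(@cnorm0_eq0 R A)/eqP; rewrite oner_eq0.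
apply: (mulfI n0); rewrite mulr1 -expr2 -cnorm_star_mul.
by rewrite star1 mulr1.
Qed.

Lemma cnorm_unitary A (w : A) : star w * w = 1 -> cnorm w = 1.
Proof.
move=> ww; apply/eqP; rewrite -(@eqrXn2 _ 2) ?cnorm_ge0//.
by rewrite -cnorm_star_mul ww cnorm1 expr1n.
Qed.

Lemma cvg_mul_cstar A (T : Type) (F : set_system T) (FF : Filter F)
    (f g : T -> realified A) (a b : realified A) :
  f @ F --> a -> g @ F --> b ->
  (fun t => (f t : A) * (g t : A) : realified A) @ F -->
  ((a : A) * (b : A) : realified A).
Proof.
move=> fa gb; apply/subr_cvg0; apply: norm_cvg0.
have fa0 : `|f t - a| @[t --> F] --> 0.
  by rewrite -(normr0 (realified A)); apply: cvg_norm; apply/subr_cvg0.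
have gb0 : `|g t - b| @[t --> F] --> 0.
  by rewrite -(normr0 (realified A)); apply: cvg_norm; apply/subr_cvg0.
have bnd0 : `|f t - a| * `|g t| + `|a| * `|g t - b| @[t --> F] --> (0 : R).
  rewrite -(addr0 0) -[X in X + _](mul0r `|b|) -[X in _ + X](mulr0 `|a|).
  by apply: cvgD; apply: cvgM => //; [exact: cvg_norm|exact: cvg_cst].
apply: (squeeze_cvgr _ (cvg_cst 0) bnd0).
apply: nearW => t.
rewrite normr_ge0/=.
have -> : ((f t : A) * (g t : A) - (a : A) * (b : A) : realified A) =
    (((f t : A) - (a : A)) * (g t : A) + (a : A) * ((g t : A) - (b : A)) : A).
  by rewrite mulrBl mulrBr addrA subrK.
apply: le_trans (cnormD _ _) _.
by apply: lerD; exact: cnormM.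
Qed.

Lemma cvg_star A (T : Type) (F : set_system T) (FF : Filter F)
    (f : T -> realified A) (a : realified A) :
  f @ F --> a ->
  (fun t => star (f t : A) : realified A) @ F --> (star (a : A) : realified A).
Proof.
move=> fa; apply/subr_cvg0; apply: norm_cvg0.
have -> : (fun t => `|(star (f t : A) : realified A) - star (a : A)|) =
    (fun t => `|f t - a|).
  by apply/funext => t; rewrite -[RHS]cnorm_star starD starN.
by rewrite -(normr0 (realified A)); apply: cvg_norm; apply/subr_cvg0.
Qed.

Let sqrt_step A (z y : A) : A := (2^-1 : R[i]) *: (z + y * y).

Let cnorm_half A (a : A) : cnorm ((2^-1 : R[i]) *: a) = 2^-1 * cnorm a.
Proof.
have -> : (2^-1 : R[i]) = (2^-1 : R)%:C by rewrite fmorphV rmorph_nat.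
by rewrite cnormZ cabs_real ger0_norm// invr_ge0.
Qed.

Let add_half A (a : A) : (2^-1 : R[i]) *: a + (2^-1 : R[i]) *: a = a.
Proof.
by rewrite -mulr2n -scaler_nat scalerA mulfV ?pnatr_eq0// scale1r.
Qed.

(** The element [c] is a square root of [1 - b * b], obtained without functional
    calculus: [1 - c] is the fixed point of the map sending [y] to half of
    [b * b + y * y]. As soon as the norm of [b] is at most 1/2, this map sends the
    ball of radius 1/2 to itself and contracts distances there by a factor 1/2.
    All iterates starting from [0] are self-adjoint and commute with [b], and
    this passes to the limit. *)
Lemma exists_sqrt_one_sub A (b : A) : selfadjoint b -> cnorm b <= 2^-1 ->
  exists c : A, [/\ selfadjoint c, b * c = c * b & b * b + c * c = 1].
Proof.
move=> bsa ble; pose z := b * b.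
pose y k : A := iter k (sqrt_step z) 0.
have zle : cnorm z <= 4^-1.
  apply: le_trans (cnormM _ _) _.
  have -> : (4^-1 : R) = 2^-1 * 2^-1 by rewrite -invfM -natrM.
  by rewrite ler_pM ?cnorm_ge0.
have yle k : cnorm (y k) <= 2^-1.
  elim: k => [|k ih]; first by rewrite cnorm0 invr_ge0.
  rewrite [y _]iterS -/(y k) cnorm_half.
  have : cnorm (z + y k * y k) <= 4^-1 + 2^-1 * 2^-1.
    apply: le_trans (cnormD _ _) _; rewrite lerD//.
    by apply: le_trans (cnormM _ _) _; rewrite ler_pM ?cnorm_ge0.
  by lra.
have ysa k : selfadjoint (y k).
  rewrite /selfadjoint; elim: k => [|k ih]; first exact: star0.
  rewrite [y _]iterS -/(y k) /sqrt_step starZ starD !starM ih bsa.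
  by rewrite fmorphV rmorph_nat.
have ycomm k : b * y k = y k * b.
  elim: k => [|k ih]; first by rewrite mulr0 mul0r.
  rewrite [y _]iterS -/(y k) /sqrt_step -scalerAr -scalerAl mulrDr mulrDl.
  by rewrite /z !mulrA ih -!mulrA ih.
(* The tail from [k] on is the [k]-th image of the whole orbit, whence no
   geometric series is needed. *)
have ydist i k : cnorm (y (i + k)%N - y k) <= 2^-1 ^+ k.
  elim: k => [|k ih].
    rewrite addn0 subr0 expr0; apply: le_trans (yle _) _; lra.
  rewrite addnS [y _.+1]iterS [y k.+1]iterS -/(y k) -/(y (i + k)%N).
  rewrite /sqrt_step -scalerBr cnorm_half exprS ler_pM2l ?invr_gt0//.
  rewrite opprD addrACA subrr add0r.
  apply: le_trans ih.
  have -> : forall p q : A, p * p - q * q = p * (p - q) + (p - q) * q.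
    by move=> p q; rewrite mulrBr mulrBl addrA subrK.
  apply: le_trans (cnormD _ _) _.
  have le1 := cnormM (y (i + k)%N) (y (i + k)%N - y k).
  have le2 := cnormM (y (i + k)%N - y k) (y k).
  have := yle (i + k)%N; have := yle k.
  have := cnorm_ge0 (y (i + k)%N - y k).
  by nra.
have [e e0|l yl] := @cnorm_complete R A y.
  have e2 : 0 < e / 2 by rewrite divr_gt0.
  have [k _ ke] := near_infty_natSinv_expn_lt (PosNum e2).
  have {ke} := ke k (leqnn k); rewrite /= div1r -exprVn => ke.
  have near_k i : (k <= i)%N -> cnorm (y i - y k) < e / 2.
    by move=> ki; rewrite -(subnK ki); exact: le_lt_trans (ydist _ _) ke.
  exists k => i j ki kj; rewrite -(subrKA (y k)) -[y k - y j]opprB.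
  rewrite [e]splitr; apply: le_lt_trans (cnormD _ _) _.
  by rewrite cnormN ltrD ?near_k.
have {}yl : (y : nat -> realified A) @ \oo --> (l : realified A).
  apply/cvgrPdist_lt => e e0; have [k kl] := yl e e0.
  by exists k => // i ki; rewrite distrC; exact: kl.
have yy := cvg_mul_cstar eventually_filter yl yl.
have lsa : selfadjoint l.
  have := cvg_star eventually_filter yl.
  rewrite (_ : (fun t => _) = (y : nat -> realified A)); last first.
    by apply/funext => k; exact: ysa.
  by move=> h; apply: (cvg_unique (@norm_hausdorff R (realified A)) h yl).
have lcomm : b * l = l * b.
  have := cvg_mul_cstar eventually_filter
    (@cvg_cst _ (b : realified A) _ \oo eventually_filter) yl.
  rewrite (_ : (fun t => _) = (fun k => y k * b : realified A)); last first.
    by apply/funext => k; exact: ycomm.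
  move=> h; have h' := cvg_mul_cstar eventually_filter yl
    (@cvg_cst _ (b : realified A) _ \oo eventually_filter).
  exact: (cvg_unique (@norm_hausdorff R (realified A)) h h').
have lfix : l + l = z + l * l.
  have h := cvgD (FF := eventually_filter)
    (@cvg_cst _ (z : realified A) _ \oo eventually_filter) yy.
  rewrite -cvg_shiftS in yl; have h' := cvgD (FF := eventually_filter) yl yl.
  apply: (cvg_unique (@norm_hausdorff R (realified A)) h' _) => //.
  rewrite [X in X @ _](_ : _ = (fun=> z : realified A) +
    (fun k => y k * y k : realified A))//.
  by apply/funext => k; exact: add_half.
exists (1 - l); split.
- by rewrite /selfadjoint starD starN star1 lsa.
- by rewrite mulrBr mulrBl mulr1 mul1r lcomm.
- have -> : (1 - l) * (1 - l) = 1 - (l + l) + l * l.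
    by rewrite mulrBr mulr1 mulrBl mul1r opprB opprD !addrA addrAC.
  rewrite lfix -addrA [- _ + _]addrC opprD [l * l + _]addrCA addrN addr0.
  by rewrite addrCA subrr addr0.
Qed.

(** If [b] is self-adjoint of norm at most 1/2, it is the real part of the
    unitary [b + 'i *: c], where [c] is a square root of [1 - b * b]. A
    *-morphism preserves unitaries, so the image of [b] is the real part of a
    unitary and has norm at most 1. Homogeneity and the C*-identity extend the
    bound to all elements. The constant is crude: only the continuity of
    *-morphisms is wanted. *)
Lemma star_morphism_bounded A B (f : {lrmorphism A -> B}) :
  star_preserving f -> forall a, cnorm (f a) <= 2 * cnorm a.
Proof.
move=> fstar.
have small (b : A) : selfadjoint b -> cnorm b <= 2^-1 -> cnorm (f b) <= 1.
  move=> bsa ble; have [c [csa bc bc1]] := exists_sqrt_one_sub bsa ble.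
  pose w : B := f b + 'i *: f c.
  have fbsa : star (f b) = f b by rewrite -fstar bsa.
  have fcsa : star (f c) = f c by rewrite -fstar csa.
  have sw : star w = f b - 'i *: f c.
    by rewrite starD starZ fbsa fcsa conjCi scaleNr.
  have w1 : cnorm w = 1.
    apply: cnorm_unitary; rewrite sw mulrDr !mulrBl -!scalerAr -!scalerAl.
    rewrite scalerA -['i * 'i]expr2 sqrCi scaleN1r opprK -!rmorphM bc.
    by rewrite subrKA -rmorphD bc1 rmorph1.
  have -> : f b = (2^-1 : R[i]) *: (w + star w).
    by rewrite sw addrACA subrr addr0 scalerDr add_half.
  rewrite cnorm_half; have := cnormD w (star w); rewrite cnorm_star w1; lra.
have sa (b : A) : selfadjoint b -> cnorm (f b) <= 2 * cnorm b.
  move=> bsa.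
  have := cnorm_ge0 b; rewrite le_eqVlt => /predU1P[b0|b0].
    by rewrite -b0 (cnorm0_eq0 _ (esym b0)) rmorph0 cnorm0 mulr0.
  have c0 : 0 < (2 * cnorm b)^-1 by rewrite invr_gt0 mulr_gt0.
  have := small ((2 * cnorm b)^-1%:C *: b).
  rewrite /selfadjoint linearZ/= !cnormZ cabs_real gtr0_norm//.
  rewrite starZR bsa => /(_ erefl) fle1.
  rewrite -[leRHS]mulr1 -ler_pdivrMl ?mulr_gt0//; apply: fle1.
  by rewrite invfM -mulrA mulVf ?mulr1 ?gt_eqF.
move=> a.
rewrite -(@ler_pXn2r _ 2) ?nnegrE ?mulr_ge0 ?cnorm_ge0//.
rewrite -cnorm_star_mul -fstar -rmorphM; apply: le_trans (sa _ _) _.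
  by rewrite /selfadjoint starM starK.
rewrite cnorm_star_mul; have := sqr_ge0 (cnorm a); lra.
Qed.
End Cstar.

(** * Functions of class C^k with values in a C*-algebra *)

Section Calculus.
Context {R : realType} {n : nat}.
Implicit Types (A B : cstarType R) (k : nat).

Lemma is_derive_comp_linear A B (L : realified A -> realified B)
    (f : 'rV[R]_n -> realified A) x v :
  linear L -> continuous L -> derivable f x v ->
  is_derive x v (L \o f) (L ('D_v f x)).
Proof.
move=> Llin Lcont fx.
have L_quot h : h^-1 *: (((L \o f) \o shift x) (h *: v) - (L \o f) x) =
    L (h^-1 *: ((f \o shift x) (h *: v) - f x)).
  have L0 : L 0 = 0.
    by have := Llin (-1) 0 0; rewrite scaler0 addr0 scaleN1r addNr.
  have LZ c y : L (c *: y) = c *: L y.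
    by rewrite -[c *: y]addr0 Llin L0 addr0.
  have LB y z : L (y - z) = L y - L z.
    by rewrite addrC -scaleN1r Llin scaleN1r addrC.
  by rewrite LZ LB.
have cvL : h^-1 *: (((L \o f) \o shift x) (h *: v) - (L \o f) x) @[h --> 0^'] -->
    L ('D_v f x).
  under eq_fun do rewrite L_quot.
  by apply: continuous_cvg; [exact: Lcont|exact: fx].
apply: DeriveDef; first by apply/cvg_ex; eexists; exact: cvL.
exact: (cvg_lim (@norm_hausdorff _ _) cvL).
Qed.

Lemma is_derive_mul A (f g : 'rV[R]_n -> realified A) x v :
  derivable f x v -> derivable g x v -> {for x, continuous g} ->
  is_derive x v (fun t => (f t : A) * (g t : A) : realified A)
    (('D_v f x : A) * (g x : A) + (f x : A) * ('D_v g x : A) : realified A).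
Proof.
move=> fx gx gc.
pose q (F : 'rV[R]_n -> realified A) h : realified A :=
  h^-1 *: ((F \o shift x) (h *: v) - F x).
have cvx : h *: v + x @[h --> (0 : R)^'] --> x.
  rewrite -[X in _ --> X]add0r -(scale0r v).
  apply: cvgD; last exact: cvg_cst.
  by apply: cvgZr_tmp; exact: nbhs_dnbhs.
have cvg_g : (fun h => g (h *: v + x)) @ (0 : R)^' --> g x.
  exact: cvg_comp cvx gc.
have q_mul h : q (fun t => (f t : A) * (g t : A) : realified A) h =
    ((q f h : A) * (g (h *: v + x) : A) + (f x : A) * (q g h : A) : A).
  have leib (c : R[i]) (a b a' b' : A) :
      c *: (a * b - a' * b') = (c *: (a - a')) * b + a' * (c *: (b - b')).
    by rewrite -scalerAl -scalerAr -scalerDr mulrBl mulrBr addrA subrK.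
  exact: leib.
have cvq : q (fun t => (f t : A) * (g t : A) : realified A) h @[h --> 0^'] -->
    (('D_v f x : A) * (g x : A) + (f x : A) * ('D_v g x : A) : realified A).
  under eq_fun do rewrite q_mul.
  by apply: cvgD; apply: cvg_mul_cstar => //; exact: cvg_cst.
apply: DeriveDef; first by apply/cvg_ex; eexists; exact: cvq.
exact: (cvg_lim (@norm_hausdorff _ _) cvq).
Qed.

Lemma class_C_continuous A k (f : 'rV[R]_n -> realified A) :
  class_C k f -> continuous f.
Proof. by case: k => [|k] []. Qed.

Lemma class_CW A k (f : 'rV[R]_n -> realified A) : class_C k.+1 f -> class_C k f.
Proof.
elim: k f => [|k ih] f [fc fd]; first by split.
by split=> // j; have [fdj /ih] := fd j.
Qed.

Lemma class_C_cst A k (a : realified A) : class_C k (fun _ : 'rV[R]_n => a).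
Proof.
elim: k a => [|k ih] a; split=> //; [exact: cst_continuous..|].
move=> j; split=> [x|]; first exact: derivable_cst.
rewrite (_ : 'D__ _ = fun=> 0)//; apply/funext => x; exact: derive_cst.
Qed.

Lemma class_CD A k (f g : 'rV[R]_n -> realified A) :
  class_C k f -> class_C k g -> class_C k (f + g).
Proof.
elim: k f g => [|k ih] f g [fc fd] [gc gd]; split=> //.
- by move=> x; apply: continuousD; [exact: fc|exact: gc].
- by move=> x; apply: continuousD; [exact: fc|exact: gc].
move=> j; have [fdj fCj] := fd j; have [gdj gCj] := gd j.
split=> [x|]; first exact: derivableD.
by rewrite (_ : 'D__ _ = 'D_(delta_mx 0 j) f + 'D_(delta_mx 0 j) g);
  [exact: ih|apply/funext => x; exact: deriveD].
Qed.

(** This single closure property covers the three operations met below: the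
    involution, the multiplication by a complex scalar and the automorphisms of
    the torus action. *)
Lemma class_C_comp_linear A B k (L : realified A -> realified B)
    (f : 'rV[R]_n -> realified A) :
  linear L -> continuous L -> class_C k f -> class_C k (L \o f).
Proof.
move=> Ll Lc; elim: k f => [|k ih] f [fc fd]; split=> //.
- by move=> x; apply: continuous_comp; [exact: fc|exact: Lc].
- by move=> x; apply: continuous_comp; [exact: fc|exact: Lc].
move=> j; have [fdj fCj] := fd j.
have dLf x := is_derive_comp_linear Ll Lc (fdj x).
split=> [x|]; first by have [] := dLf x.
rewrite (_ : 'D__ _ = L \o 'D_(delta_mx 0 j) f); first exact: ih.
by apply/funext => x; have [] := dLf x.
Qed.

(** The derivative of a product is a sum of two products of functions of class
    C^k, which closes the induction on [k]. *)
Lemma class_C_mul A k (f g : 'rV[R]_n -> realified A) :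
  class_C k f -> class_C k g ->
  class_C k (fun t => (f t : A) * (g t : A) : realified A).
Proof.
elim: k f g => [|k ih] f g fC gC.
  by split=> // x; exact: (cvg_mul_cstar _ (fC.1 x) (gC.1 x)).
split=> [x|j].
  exact: (cvg_mul_cstar _ (fC.1 x) (gC.1 x)).
have [fdj fCj] := fC.2 j; have [gdj gCj] := gC.2 j.
have dfg x := is_derive_mul (fdj x) (gdj x) (gC.1 x).
split=> [x|]; first by have [] := dfg x.
rewrite (_ : 'D__ _ =
  (fun t => ('D_(delta_mx 0 j) f t : A) * (g t : A) : realified A) +
  (fun t => (f t : A) * ('D_(delta_mx 0 j) g t : A) : realified A)).
  by apply: class_CD; apply: ih => //; exact: class_CW.
by apply/funext => x; have [] := dfg x.
Qed.

End Calculus.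

(** * The derivations of the smooth subalgebra *)

Section TorusDerivations.
Context {R : realType} {n : nat} {A : cstarType R}.

Lemma continuous_star : continuous (star : realified A -> realified A).
Proof. by move=> a; exact: (cvg_star (nbhs_filter a) cvg_id). Qed.

Lemma linear_star : linear (star : realified A -> realified A).
Proof. by move=> c a b; rewrite [LHS]starD [X in X + _]starZR. Qed.

Lemma continuous_scale (c : R[i]) :
  continuous ( *:%R c : realified A -> realified A).
Proof.
move=> a.
rewrite (_ : ( *:%R c : realified A -> realified A) =
    (fun x => ((c%:A : A) * (x : A) : A))); last first.
  by apply/funext => x; rewrite mulr_algl.
exact: (cvg_mul_cstar (nbhs_filter a) (cvg_cst _) cvg_id).
Qed.

Lemma linear_scale (c : R[i]) :
  linear ( *:%R c : realified A -> realified A).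
Proof.
move=> d a b; rewrite [LHS](@scalerDr _ A); congr (_ + _ : A).
by rewrite [LHS](@scalerA _ A) [RHS](@scalerA _ A) mulrC.
Qed.

Lemma continuous_star_morphism (B : cstarType R) (f : {lrmorphism A -> B}) :
  star_preserving f -> continuous (f : realified A -> realified B).
Proof.
move=> fstar a; apply/(cvgrPdist_lt (FF := nbhs_filter a)) => e e0.
have e2 : 0 < e / 2 by rewrite divr_gt0.
apply: filterS (nbhsx_ballx a _ e2) => b; rewrite -ball_normE /= => ab.
have -> : `|(f a : realified B) - f b| = cnorm (f (a - b)) by rewrite rmorphB.
apply: le_lt_trans (star_morphism_bounded fstar _) _.
by rewrite -ltr_pdivlMl// mulrC.
Qed.

Lemma linear_star_morphism (B : cstarType R) (f : {lrmorphism A -> B}) :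
  linear (f : realified A -> realified B).
Proof. by move=> c a b; rewrite [LHS]linearP. Qed.

(** The images of the generators under [f1] satisfy the rotation relations, so
    [f1] and [f2] are two solutions of one universal problem. *)
Lemma quantum_torus_hom_ext (Theta : 'M[R]_n) (u : 'I_n -> A) (B : cstarType R)
    (f1 f2 : {lrmorphism A -> B}) :
  is_quantum_torus Theta u -> star_preserving f1 -> star_preserving f2 ->
  (forall j, f1 (u j) = f2 (u j)) -> f1 =1 f2.
Proof.
move=> [[uU uR] univ] s1 s2 f12 a.
have [|f [_ funiq]] := univ B (f1 \o u).
  split=> [j|j k] /=.
    by split; rewrite -s1 -rmorphM; rewrite ?(uU j).1 ?(uU j).2 rmorph1.
  rewrite -!(rmorphM f1) uR; exact: linearZ.
by rewrite (funiq f1)// (funiq f2)// => j; rewrite -f12.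
Qed.

Lemma expi2piD (x y : R) : expi2pi (x + y) = expi2pi x * expi2pi y.
Proof.
rewrite /expi2pi mulrDr cosD sinD; simpc; congr (_ +i* _).
by rewrite addrC mulrC.
Qed.

Lemma expi2pi0 : expi2pi (0 : R) = 1.
Proof. by rewrite /expi2pi mulr0 cos0 sin0. Qed.

Context {Theta : 'M[R]_n} {u : 'I_n -> A} {alpha : 'rV[R]_n -> {lrmorphism A -> A}}
  (torus : is_quantum_torus Theta u) (action : is_torus_action u alpha).

Lemma torus_action0 a : alpha 0 a = a.
Proof.
apply: (@quantum_torus_hom_ext _ _ _ (alpha 0) idfun torus (action 0).1) => // j.
by rewrite (action 0).2 mxE expi2pi0 scale1r.
Qed.

(** The action is only known on generators; that it is a group action follows
    from the uniqueness in the universal property. *)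
Lemma torus_actionD s t a : alpha (s + t) a = alpha s (alpha t a).
Proof.
apply: (@quantum_torus_hom_ext _ _ _ (alpha (s + t)) (alpha s \o alpha t) torus
  (action _).1) => [b|j] /=.
  by rewrite (action t).1 (action s).1.
by rewrite !(action _).2 linearZ/= (action s).2 scalerA mxE addrC expi2piD.
Qed.

Lemma smooth_linear c (a b : A) : smooth alpha a -> smooth alpha b ->
  smooth alpha (c *: a + b).
Proof.
move=> sa sb k.
rewrite (_ : orbit_map _ _ =
  (( *:%R c : realified A -> realified A) \o orbit_map alpha a) + orbit_map alpha b).
  apply: class_CD (sb k); apply: class_C_comp_linear (sa k).
    exact: linear_scale.
  exact: continuous_scale.
by apply/funext => t; rewrite /orbit_map [LHS]linearP.
Qed.

Lemma smooth0 : smooth alpha 0.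
Proof.
move=> k; rewrite (_ : orbit_map _ _ = fun=> 0); first exact: class_C_cst.
by apply/funext => t; exact: rmorph0.
Qed.

Lemma smooth1 : smooth alpha 1.
Proof.
move=> k; rewrite (_ : orbit_map _ _ = fun=> (1 : A)); first exact: class_C_cst.
by apply/funext => t; exact: rmorph1.
Qed.

Lemma smoothZ c (a : A) : smooth alpha a -> smooth alpha (c *: a).
Proof. by move=> sa; rewrite -[c *: a]addr0; exact: smooth_linear smooth0. Qed.

Lemma smoothD (a b : A) : smooth alpha a -> smooth alpha b -> smooth alpha (a + b).
Proof. by move=> sa sb; rewrite -[a]scale1r; exact: smooth_linear. Qed.

Lemma smooth_sum (I : Type) (r : seq I) (f : I -> A) :
  (forall i, smooth alpha (f i)) -> smooth alpha (\sum_(i <- r) f i).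
Proof.
by move=> sf; elim/big_ind : _ => // [|a b]; [exact: smooth0|exact: smoothD].
Qed.

Lemma smoothM (a b : A) : smooth alpha a -> smooth alpha b -> smooth alpha (a * b).
Proof.
move=> sa sb k; rewrite (_ : orbit_map _ _ =
  (fun t => (orbit_map alpha a t : A) * (orbit_map alpha b t : A) : realified A)).
  exact: class_C_mul.
by apply/funext => t; exact: rmorphM.
Qed.

Lemma orbit_star (a : A) : orbit_map alpha (star a) =
  (star : realified A -> realified A) \o orbit_map alpha a.
Proof. by apply/funext => t; exact: (action t).1. Qed.

Lemma smooth_star (a : A) : smooth alpha a -> smooth alpha (star a).
Proof.
move=> sa k; rewrite orbit_star.
by apply: class_C_comp_linear (sa k); [exact: linear_star|exact: continuous_star].
Qed.

Lemma derivation_at0 delta : derivation alpha delta -> delta 0 = 0.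
Proof.
move=> ddelta; have := der_linear ddelta 1 smooth0 smooth0.
by rewrite !scale1r addr0 => /eqP; rewrite addrC -subr_eq subrr eq_sym => /eqP.
Qed.

Lemma derivationZ delta c (a : A) : derivation alpha delta -> smooth alpha a ->
  delta (c *: a) = c *: delta a.
Proof.
move=> ddelta sa; rewrite -[c *: a]addr0 (der_linear ddelta)//; last exact: smooth0.
by rewrite derivation_at0// addr0.
Qed.

Let e (j : 'I_n) : 'rV[R]_n := delta_mx 0 j.

Lemma partialE j (a : A) : smooth alpha a ->
  partial alpha j a = 'D_(e j) (orbit_map alpha a) 0.
Proof. by move=> sa; rewrite /partial /on_smooth patchT// inE. Qed.

Lemma smooth_derivable j (a : A) t : smooth alpha a ->
  derivable (orbit_map alpha a) t (e j).
Proof. by move=> sa; exact: ((sa 1).2 j).1. Qed.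

Lemma derive_shift (f : 'rV[R]_n -> realified A) t v :
  'D_v (f \o shift t) 0 = 'D_v f t.
Proof.
rewrite /derive; suff -> : (fun h : R => h^-1 *:
    (((f \o shift t) \o shift 0) (h *: v) - (f \o shift t) 0)) =
  (fun h => h^-1 *: ((f \o shift t) (h *: v) - f t)) by [].
by apply/funext => h /=; rewrite addr0 add0r.
Qed.

(** Since [alpha t] is continuous it can be exchanged with the limit defining the
    derivative at [0], and the group law turns the result into the derivative
    at [t]. Hence differentiating the element amounts to differentiating its
    whole orbit, and partial derivatives of smooth elements are smooth. *)
Lemma orbit_partial j (a : A) : smooth alpha a ->
  orbit_map alpha (partial alpha j a) = 'D_(e j) (orbit_map alpha a).
Proof.
move=> sa; apply/funext => t.
rewrite /orbit_map partialE//.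
have [_ <-] := is_derive_comp_linear (linear_star_morphism (alpha t))
  (continuous_star_morphism (action t).1) (smooth_derivable (j := j) (t := 0) sa).
rewrite -(derive_shift (orbit_map alpha a) t (e j)).
rewrite (_ : _ \o _ = orbit_map alpha a \o shift t)//; apply/funext => x /=.
by rewrite /orbit_map -torus_actionD addrC.
Qed.

(** For a connection, linearity in the direction, the Leibniz rule and the
    compatibility with the metric are statements about derivations; this lemma
    makes them applicable in the coordinate directions. *)
Lemma derivation_partial j : derivation alpha (partial alpha j).
Proof.
split.
- by move=> a sa; rewrite /partial /on_smooth patchC// inE.
- move=> a sa k; rewrite orbit_partial//; exact: ((sa k.+1).2 j).2.
- move=> c a b sa sb; rewrite !partialE//; last exact: smooth_linear.
  rewrite (_ : orbit_map _ _ =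
    (( *:%R c : realified A -> realified A) \o orbit_map alpha a) +
    orbit_map alpha b); last first.
    by apply/funext => t; rewrite /orbit_map [LHS]linearP.
  have [dca <-] := is_derive_comp_linear (linear_scale c) (@continuous_scale c)
    (smooth_derivable (j := j) (t := 0) sa).
  by rewrite deriveD//; exact: smooth_derivable.
- move=> a b sa sb; rewrite !partialE//; last exact: smoothM.
  have [_] := is_derive_mul (smooth_derivable (j := j) (t := 0) sa)
    (smooth_derivable (j := j) (t := 0) sb)
    (@class_C_continuous _ _ _ _ _ (sb 0%N) 0).
  have orbit0 c : orbit_map alpha c 0 = c by exact: torus_action0.
  rewrite !orbit0 => <-; rewrite (_ : orbit_map alpha (a * b) =
    (fun t => (orbit_map alpha a t : A) * (orbit_map alpha b t : A)))//.
  by apply/funext => t; exact: rmorphM.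
- move=> a sa; rewrite !partialE//; last exact: smooth_star.
  have [_ <-] := is_derive_comp_linear linear_star continuous_star
    (smooth_derivable (j := j) (t := 0) sa).
  by rewrite orbit_star.
Qed.

Lemma derivation_ad (a : A) : smooth alpha a -> skewadjoint a ->
  derivation alpha (ad alpha a).
Proof.
move=> sa askew.
have adE b : smooth alpha b -> ad alpha a b = a * b - b * a.
  by move=> sb; rewrite /ad /on_smooth patchT// inE.
have smoothB b c : smooth alpha b -> smooth alpha c -> smooth alpha (b - c).
  by move=> sb sc; rewrite addrC -scaleN1r; exact: smooth_linear.
split.
- by move=> b sb; rewrite /ad /on_smooth patchC// inE.
- by move=> b sb; rewrite adE//; apply: smoothB; exact: smoothM.
- move=> c b d sb sd; rewrite !adE//; last exact: smooth_linear.
  rewrite mulrDr mulrDl -scalerAr -scalerAl scalerBr opprD.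
  by rewrite addrACA.
- move=> b d sb sd; rewrite !adE//; last exact: smoothM.
  by rewrite mulrBl mulrBr !mulrA subrKA.
- move=> b sb; rewrite !adE//; last exact: smooth_star.
  by rewrite starD starN !starM askew mulrN mulNr opprK addrC.
Qed.

Lemma derivation_linear (c : R) (d1 d2 : A -> A) :
  derivation alpha d1 -> derivation alpha d2 ->
  derivation alpha (c%:C *: d1 + d2).
Proof.
move=> D1 D2.
have E a : (c%:C *: d1 + d2) a = c%:C *: d1 a + d2 a by [].
split=> *; rewrite !E.
- by rewrite (der_out D1)// (der_out D2)// scaler0 addr0.
- by apply: smooth_linear; [exact: der_smooth D1 _ _|exact: der_smooth D2 _ _].
- rewrite (der_linear D1)// (der_linear D2)// !scalerDr !scalerA mulrC.
  by rewrite addrACA.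
- rewrite (der_leibniz D1)// (der_leibniz D2)//.
  rewrite scalerDr mulrDl mulrDr scalerAl scalerAr.
  by rewrite addrACA.
- by rewrite (der_star D1)// (der_star D2)// starD starZR.
Qed.

End TorusDerivations.

(** * Uniqueness of the Levi-Civita connection *)

Section RiemannianMetrics.
Context {R : realType} {n : nat} {A : cstarType R}.
Implicit Types (g : 'M[A]_n) (X Y Z : 'rV[A]_n).

Lemma complex_scaleE (c : R[i]) X j : complex_scale c X 0 j = c *: X 0 j.
Proof. by rewrite !mxE mulr_algl. Qed.

Lemma complex_scaleA (c d : R[i]) X :
  complex_scale c (complex_scale d X) = complex_scale (c * d) X.
Proof. by apply/rowP => j; rewrite !complex_scaleE scalerA. Qed.

Lemma complex_scale1 X : complex_scale 1 X = X.
Proof. by apply/rowP => j; rewrite complex_scaleE scale1r. Qed.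

Lemma complex_scale_mul (c : R[i]) X g :
  complex_scale c X *m g = complex_scale c (X *m g).
Proof. by rewrite /complex_scale -scalemxAl. Qed.

Lemma ip_scale_metric (c : R) g X Y :
  ip (scale_metric c g) X Y = c%:C *: ip g X Y.
Proof.
rewrite /ip /ip_st scaler_sumr; apply: eq_bigr => j _.
rewrite scalerAl; congr (_ * _); rewrite !mxE scaler_sumr.
by apply: eq_bigr => k _; rewrite mxE scalerAr.
Qed.

Lemma ip_complex_scale (c d : R) g X Y :
  ip g (complex_scale c%:C X) (complex_scale d%:C Y) = (c * d)%:C *: ip g X Y.
Proof.
rewrite /ip /ip_st scaler_sumr complex_scale_mul; apply: eq_bigr => j _.
rewrite !complex_scaleE starZR -scalerAl -scalerAr scalerA.
by rewrite rmorphM.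
Qed.

Lemma ipBl g X Y Z : ip g (X - Y) Z = ip g X Z - ip g Y Z.
Proof.
rewrite /ip /ip_st mulmxBl -sumrB; apply: eq_bigr => j _.
by rewrite !mxE mulrBl.
Qed.

Lemma ip_basis g X l : ip g X (basis_rv l) = (X *m g) 0 l.
Proof.
rewrite /ip /ip_st (bigD1 l)//= big1 ?addr0 => [|j jl].
  by rewrite [basis_rv l 0 l]mxE !eqxx star1 mulr1.
by rewrite [basis_rv l 0 j]mxE (negbTE jl) andbF star0 mulr0.
Qed.

Context {alpha : 'rV[R]_n -> {lrmorphism A -> A}}.

Lemma ip_hermitian g X Y : riemannian alpha g -> star (ip g X Y) = ip g Y X.
Proof.
move=> [[h ghh] _ gsa].
have g_star j k : star (g j k) = g k j.
  rewrite [in LHS]ghh [in RHS]ghh !mxE star_sum; apply: eq_bigr => i _.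
  by rewrite !mxE starM starK.
rewrite /ip /ip_st star_sum.
under eq_bigr => j _ do rewrite starM starK mxE star_sum mulr_sumr.
under [RHS]eq_bigr => j _ do rewrite mxE mulr_suml.
rewrite exchange_big; apply: eq_bigr => j _; apply: eq_bigr => k _.
by rewrite starM g_star mulrA.
Qed.

Lemma ip_nondegenerate g X : riemannian alpha g ->
  (forall l, ip g X (basis_rv l) = 0) -> X = 0.
Proof.
move=> [_ [h [gh _]] _] X0; rewrite -[X]mulmx1 -gh mulmxA.
rewrite (_ : X *m g = 0) ?mul0mx//.
by apply/rowP => l; rewrite -ip_basis X0 mxE.
Qed.

Lemma smooth_basis k : smooth_rv alpha (@basis_rv R n A k).
Proof.
by move=> j; rewrite mxE eqxx/=; case: eqP => _; [exact: smooth1|exact: smooth0].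
Qed.

End RiemannianMetrics.

Section LeviCivita.
Context {R : realType} {n : nat} {Theta : 'M[R]_n} {A : cstarType R}
  {u : 'I_n -> A} {alpha : 'rV[R]_n -> {lrmorphism A -> A}} {tau : A -> R[i]}
  (torus : is_quantum_torus Theta u) (action : is_torus_action u alpha).
Implicit Types (g : 'M[A]_n) (X Y Z : 'rV[A]_n).

Lemma smooth_complex_scale c X :
  smooth_rv alpha X -> smooth_rv alpha (complex_scale c X).
Proof. by move=> sX j; rewrite complex_scaleE; exact: smoothZ. Qed.

Lemma smooth_ip g X Y : riemannian alpha g -> smooth_rv alpha X ->
  smooth_rv alpha Y -> smooth alpha (ip g X Y).
Proof.
move=> [_ _ gs] sX sY; apply: smooth_sum => j.
apply: smoothM; last by apply: (smooth_star action); exact: sY.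
by rewrite mxE; apply: smooth_sum => k; apply: smoothM; [exact: sX|exact: (gs k j).2].
Qed.

(** Both axioms that mention the metric are homogeneous in it: a
    nonzero real factor comes out of the inner product and cancels. *)
Lemma levi_civita_unscale (c : R) g nabla : c != 0 -> riemannian alpha g ->
  levi_civita alpha tau (scale_metric c g) nabla -> levi_civita alpha tau g nabla.
Proof.
move=> c0 rg [lcs lc1 lc2 lcl lca lcr lct lcm].
have cC0 : c%:C != 0 by rewrite fmorph_eq0.
split=> //.
- move=> j k l; have := lcr j k l; rewrite ip_scale_metric /selfadjoint starZR.
  exact: scalerI.
- move=> delta X Y ddelta sX sY; apply: (scalerI cC0).
  rewrite scalerDr -!ip_scale_metric -lcm// ip_scale_metric.
  by rewrite (derivationZ _ ddelta)//; exact: smooth_ip.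
Qed.

Lemma smooth_rv0 : smooth_rv alpha (0 : 'rV[A]_n).
Proof. by move=> j; rewrite mxE; exact: smooth0. Qed.

Lemma connection0 g nabla delta : levi_civita alpha tau g nabla ->
  derivation alpha delta -> nabla delta 0 = 0.
Proof.
move=> lc ddelta; have := lc_leibniz lc ddelta smooth0 smooth_rv0.
by rewrite (derivation_at0 ddelta) !scale0r addr0.
Qed.

Lemma connectionZ g nabla delta c X : levi_civita alpha tau g nabla ->
  derivation alpha delta -> smooth_rv alpha X ->
  nabla delta (complex_scale c X) = complex_scale c (nabla delta X).
Proof.
move=> lc ddelta sX; rewrite -[complex_scale c X]addr0.
by rewrite (lc_linear2 lc)//; [rewrite (connection0 lc)// addr0|exact: smooth_rv0].
Qed.

Section Uniqueness.
Context {g : 'M[A]_n} {nabla nabla' : (A -> A) -> 'rV[A]_n -> 'rV[A]_n}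
  (g_riem : riemannian alpha g)
  (lc : levi_civita alpha tau g nabla) (lc' : levi_civita alpha tau g nabla').

(** Koszul's argument. Let [T j k l] be the inner product with the basis vector
    of index [l] of the difference of the two connections in direction [j] at
    the basis vector of index [k]. Absence of torsion makes [T] symmetric in
    [j] and [k]; compatibility with the metric, together with the realness
    axiom, makes it skew-symmetric in [k] and [l]. A tensor with both symmetries
    vanishes. The realness axiom replaces the commutativity of the function
    algebra: it identifies the two terms of the compatibility axiom, which
    otherwise are only adjoint to each other. *)
Lemma levi_civita_unique_basis j k :
  nabla (partial alpha j) (basis_rv k) = nabla' (partial alpha j) (basis_rv k).
Proof.
pose E j k := nabla (partial alpha j) (basis_rv k) -
              nabla' (partial alpha j) (basis_rv k).
pose T j k l := ip g (E j k) (basis_rv l).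
have E_sym i m : E i m = E m i.
  by rewrite /E (lc_torsion lc) (lc_torsion lc').
have T_sym i m l : T i m l = T m i l by rewrite /T E_sym.
have T_sa i m l : star (T i m l) = T i m l.
  by rewrite /T /E ipBl starD starN (lc_real lc) (lc_real lc').
have T_skew i m l : T i m l = - T i l m.
  have dp := derivation_partial torus action i.
  have := lc_metric lc dp (smooth_basis m) (smooth_basis l).
  rewrite (lc_metric lc' dp (smooth_basis m) (smooth_basis l)).
  rewrite -[ip g (basis_rv m) _](ip_hermitian _ _ g_riem).
  rewrite -[ip g (basis_rv m) (nabla _ _)](ip_hermitian _ _ g_riem).
  move/eqP; rewrite eq_sym -subr_eq0 opprD addrACA -starN -starD -!ipBl.
  by rewrite -/(T i m l) -/(T i l m) T_sa addr_eq0 => /eqP.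
have T0 i m l : T i m l = 0.
  have TN : T i m l = - T i m l.
    rewrite [LHS]T_skew (T_sym i l m) (T_skew l i m) opprK.
    by rewrite (T_sym l m i) (T_skew m l i) (T_sym m i l).
  have : (2 : R[i]) *: T i m l == 0.
    by rewrite scaler_nat mulr2n {1}TN addNr.
  by rewrite scaler_eq0 pnatr_eq0 => /eqP.
by apply/eqP; rewrite -subr_eq0; apply/eqP/(ip_nondegenerate g_riem) => l; exact: T0.
Qed.

Lemma eq_connection_basis delta : derivation alpha delta ->
  (forall k, nabla delta (basis_rv k) = nabla' delta (basis_rv k)) ->
  forall X, smooth_rv alpha X -> nabla delta X = nabla' delta X.
Proof.
move=> ddelta eqb X sX; rewrite [X]row_sum_delta.
have sterm i : smooth_rv alpha (X 0 i *: basis_rv i).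
  by move=> j; rewrite mxE; apply: smoothM; [exact: sX|exact: smooth_basis].
suff [] : smooth_rv alpha (\sum_i X 0 i *: delta_mx 0 i) /\
  nabla delta (\sum_i X 0 i *: delta_mx 0 i) =
  nabla' delta (\sum_i X 0 i *: delta_mx 0 i) by [].
elim/big_rec : _ => [|i Y _ [sY YE]].
  by rewrite (connection0 lc)// (connection0 lc')//; split=> //; exact: smooth_rv0.
split.
  by move=> j; rewrite mxE; apply: smoothD; [exact: sterm|exact: sY].
rewrite -[_ *: _]complex_scale1 (lc_linear2 lc)// (lc_linear2 lc')// YE.
by rewrite (lc_leibniz lc)// ?(lc_leibniz lc')// ?eqb//; exact: smooth_basis.
Qed.

(** By the hypothesis on the matrix, a derivation is a real combination of the
    coordinate derivations plus an inner one; connections are linear in the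
    derivation, and on inner derivations they are prescribed. *)
Lemma levi_civita_unique : generically_transcendental alpha tau ->
  forall delta X, derivation alpha delta -> smooth_rv alpha X ->
    nabla delta X = nabla' delta X.
Proof.
move=> gt delta X ddelta sX.
have [[p a] dec] := gt _ ddelta.
have [sa askew ta ->] : [/\ smooth alpha a, skewadjoint a, tau a = 0 &
    delta = \sum_(j < n) (p 0 j)%:C *: partial alpha j + ad alpha a] := dec.1.
suff [] : derivation alpha
    (\sum_(j < n) (p 0 j)%:C *: partial alpha j + ad alpha a) /\
  nabla (\sum_(j < n) (p 0 j)%:C *: partial alpha j + ad alpha a) X =
  nabla' (\sum_(j < n) (p 0 j)%:C *: partial alpha j + ad alpha a) X by [].
elim/big_rec : _ => [|j d _ [dd IH]].
  by rewrite add0r (lc_ad lc)// (lc_ad lc')//; split=> //; exact: derivation_ad.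
have dp := derivation_partial torus action j.
rewrite -addrA; split; first exact: derivation_linear.
rewrite (lc_linear1 lc)// (lc_linear1 lc')// IH; congr (complex_scale _ _ + _).
by apply: eq_connection_basis => // k; exact: levi_civita_unique_basis.
Qed.
End Uniqueness.
End LeviCivita.

(** * Isometric bundles are at propinquity zero *)

Section IsometricBundles.
Context {R : realType}.

Lemma Haus_refl_le0 (T : Type) (d : T -> T -> \bar R) (S : set T) :
  (forall x, S x -> (d x x <= 0)%E) -> (Haus d S S <= 0)%E.
Proof.
move=> d0; rewrite /Haus ge_max; apply/andP; split;
  by apply: ge_ereal_sup => _ [x Sx <-]; apply: (le_trans _ (d0 x Sx));
     apply: ereal_inf_lbound; exists x.
Qed.

Lemma mk_refl_le0 (A : cstarType R) (L : A -> \bar R) phi : (mk L phi phi <= 0)%E.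
Proof.
by apply: ge_ereal_sup => _ [a _ <-]; rewrite subrr /cabs normr0.
Qed.

Context {t : admissible_triple R}.

Lemma unit_ball0 (O : bundle R) : is_mqvb t O -> unit_ball (b_D O) 0.
Proof.
move=> mO; rewrite /unit_ball /= -[X in b_D O X](scaler0 _ ((0 : R[i])%:A)).
by rewrite [b_D O _](mqvb_normZ mO 0 (mqvb_dom0 mO)) /cabs normr0 mul0e.
Qed.

Lemma kdist_refl_le0 (O : bundle R) x : is_mqvb t O -> (kdist (O := O) x x <= 0)%E.
Proof.
move=> mO; apply: ge_ereal_sup => _ [w _ <-]; rewrite subrr.
have := hm_linear (mqvb_hilbert mO) (-1) 0 0 w.
by rewrite scaler0 addr0 mulN1r addNr => ->; rewrite cnorm0.
Qed.

(** The basic reach is a supremum over the unit ball of the Lipschitz seminorm,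
    which contains [0], of infima of nonnegative numbers. *)
Lemma bridge_length_ge0 (g : modular_bridge t) : (0 <= bridge_length g)%E.
Proof.
rewrite /bridge_length /reach /basic_reach !le_max; apply/orP; right.
apply/orP; left; apply/orP; left.
have L0 : unit_ball (b_L (br_dom g)) 0.
  have /seteqP[_ h] := qcms_ker (mqvb_qcms (br_dom_mqvb g)).
  have L00 : b_L (br_dom g) 0 = 0%E by apply: h; exists 0 => //; rewrite scale0r.
  by rewrite /unit_ball /= L00.
apply: le_trans (ereal_sup_ubound _); last by exists 0.
by apply: le_ereal_inf_tmp => _ [a _ <-]; rewrite lee_fin cnorm_ge0.
Qed.

Lemma propinquity_ge0 (O1 O2 : bundle R) : (0 <= propinquity t O1 O2)%E.
Proof.
apply: le_ereal_inf_tmp => _ [m [g [_ _ _ ->]]].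
by apply: sume_ge0 => j _; exact: bridge_length_ge0.
Qed.

(** The bridge has the algebra [A] itself in the middle, the unit as pivot, the
    identity as both embeddings, the whole unit ball of [D1] as anchors and its
    image under [Phi] as co-anchors. Each constituent of its length compares
    objects that the bridge identifies: every state is in the level set of the
    unit, the anchors and co-anchors exhaust the unit balls, and [Phi] preserves
    the inner products with them. *)
Lemma propinquity_isometry (A : cstarType R) (L : A -> \bar R)
    (X1 X2 : lmodType A) (ip1 : X1 -> X1 -> A) (ip2 : X2 -> X2 -> A)
    (D1 : X1 -> \bar R) (D2 : X2 -> \bar R) (Phi : X1 -> X2) :
  (exists phi : A -> R[i], state phi) ->
  is_mqvb t (Bundle L ip1 D1) -> is_mqvb t (Bundle L ip2 D2) ->
  (forall x y, ip2 (Phi x) (Phi y) = ip1 x y) ->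
  (forall x, D2 (Phi x) = D1 x) -> (forall y, exists x, Phi x = y) ->
  propinquity t (Bundle L ip1 D1) (Bundle L ip2 D2) = 0%E.
Proof.
move=> [phi phi_state] m1 m2 Phi_ip Phi_D Phi_surj.
have one_level : @state_level R A 1 = @state R A.
  apply/seteqP; split=> psi; first by case.
  move=> psi_state; have [psi_lin _ _] := psi_state.
  have psi0 : psi 0 = 0.
    by have := psi_lin (-1) 0 0; rewrite scaler0 addr0 mulN1r addNr.
  by split=> //; rewrite subrr ?mulr0 ?mul0r.
pose ball1 := {x : X1 | unit_ball D1 x}.
have Phi_ball (nu : ball1) : unit_ball D2 (Phi (sval nu)).
  by rewrite /unit_ball /= Phi_D; exact: (svalP nu).
have one_sa : selfadjoint (1 : A) by exact: star1.
have one_level0 : state_level (1 : A) !=set0 by rewrite one_level; exists phi.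
have id_star : star_preserving (idfun : {lrmorphism A -> A}) by [].
have id_inj : injective (idfun : {lrmorphism A -> A}) by [].
have ball1_inhabited : inhabited ball1.
  by apply: inhabits; exists 0; exact: (unit_ball0 m1).
pose g : modular_bridge t := @ModularBridge R t (Bundle L ip1 D1) (Bundle L ip2 D2)
  m1 m2 A 1 one_sa one_level0 (cnorm1 A) idfun idfun id_star id_star
  id_inj id_inj ball1 ball1_inhabited (fun nu => sval nu) (fun nu => Phi (sval nu))
  (fun nu => svalP nu) Phi_ball.
have bs0 a : bridge_seminorm (g := g) a a = 0%E.
  by rewrite /bridge_seminorm /= mulr1 mul1r subrr cnorm0.
suff g0 : (bridge_length g <= 0)%E.
  apply/eqP; rewrite eq_le propinquity_ge0 andbT; apply: le_trans g0.
  apply: ereal_inf_lbound; exists 0%N, (fun=> g); split=> //.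
    by case.
  by rewrite big_ord_recl big_ord0 adde0.
rewrite /bridge_length ge_max; apply/andP; split.
  rewrite /bridge_height /= one_level.
  rewrite (_ : [set psi \o idfun | psi in @state R A] = @state R A); last first.
    by apply/seteqP; split=> [_ [psi ? <-]|psi ?] //; exists psi.
  by rewrite ge_max !Haus_refl_le0// => psi _; exact: mk_refl_le0.
rewrite /reach ge_max; apply/andP; split.
  rewrite /basic_reach ge_max; apply/andP; split;
  by apply: ge_ereal_sup => _ [a La <-]; rewrite -[leRHS](bs0 a);
    apply: ereal_inf_lbound; exists a.
rewrite -[leRHS]adde0; apply: leeD.
  apply: ge_ereal_sup => _ [nu _ <-]; apply: ge_ereal_sup => _ [nu' _ <-] /=.
  by rewrite !Phi_ip !bs0 maxxx.
rewrite /imprint ge_max; apply/andP; split.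
  rewrite (_ : range _ = unit_ball D1).
    by apply: Haus_refl_le0 => x _; exact: (kdist_refl_le0 _ m1).
  apply/seteqP; split=> [_ [nu _ <-]|x Dx]; first exact: (svalP nu).
  by exists (exist _ x Dx).
rewrite (_ : range _ = unit_ball D2).
  by apply: Haus_refl_le0 => x _; exact: (kdist_refl_le0 _ m2).
apply/seteqP; split=> [_ [nu _ <-]|y Dy]; first exact: Phi_ball.
have [x xy] := Phi_surj y.
have Dx : unit_ball D1 x by rewrite /unit_ball /= -Phi_D xy.
by exists (exist _ x Dx).
Qed.

End IsometricBundles.

(** * Rescaling the metric *)

Section Rescaling.
Context {R : realType} {n : nat} {A : cstarType R}
  {alpha : 'rV[R]_n -> {lrmorphism A -> A}} {N : 'rV[R]_n -> R} {tau : A -> R[i]}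
  {g : 'M[A]_n}.
Implicit Types (r s c : R) (X Y : 'rV[A]_n) (nabla : (A -> A) -> 'rV[A]_n -> 'rV[A]_n).

Lemma hnorm_rescale r s c X : c * c * s = r ->
  hnorm (ip (scale_metric s g)) (complex_scale c%:C X) =
  hnorm (ip (scale_metric r g)) X.
Proof.
move=> <-; rewrite /hnorm ip_complex_scale !ip_scale_metric scalerA.
by rewrite -rmorphM.
Qed.

Lemma complex_scaleVK c X : c != 0 ->
  complex_scale c^-1%:C (complex_scale c%:C X) = X.
Proof. by move=> c0; rewrite complex_scaleA -rmorphM mulVf// complex_scale1. Qed.

Lemma D_norm_rescale r s c nabla_r nabla_s X : c != 0 -> c * c * s = r ->
  (forall delta X, derivation alpha delta -> smooth_rv alpha X ->
    nabla_s delta (complex_scale c%:C X) = complex_scale c%:C (nabla_r delta X)) ->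
  D_norm alpha N tau (scale_metric s g) nabla_s (complex_scale c%:C X) =
  D_norm alpha N tau (scale_metric r g) nabla_r X.
Proof.
move=> c0 ccs nabla_rs; rewrite /D_norm.
have -> : `[< smooth_rv alpha (complex_scale c%:C X) >] = `[< smooth_rv alpha X >].
  apply: asbool_equiv_eq; split=> sX; last exact: smooth_complex_scale.
  by rewrite -[X](complex_scaleVK X c0); exact: smooth_complex_scale.
case: asboolP => // sX; rewrite (hnorm_rescale _ ccs); congr maxe.
rewrite /nabla_norm; congr ereal_sup.
by apply/seteqP; split=> _ [delta [dd d1] <-]; exists delta => //;
  rewrite nabla_rs// (hnorm_rescale _ ccs).
Qed.

(** One inequality only, stated for two norms that play symmetric roles: the
    other one is its instance for the inverse factor. *)
Lemma D_minkowski_rescale_le r s c nabla_r nabla_s X : c != 0 -> c * c * s = r ->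
  (forall delta X, derivation alpha delta -> smooth_rv alpha X ->
    nabla_s delta (complex_scale c%:C X) = complex_scale c%:C (nabla_r delta X)) ->
  (D_minkowski alpha N tau (scale_metric s g) nabla_s (complex_scale c%:C X) <=
   D_minkowski alpha N tau (scale_metric r g) nabla_r X)%E.
Proof.
move=> c0 ccs nabla_rs; apply: ereal_inf_le_tmp => _ [x [x0 [Y Ycl ->]] <-].
exists x => //; split=> //; exists (complex_scale c%:C Y); last first.
  by rewrite !complex_scaleA mulrC.
move=> B [e e0 eB].
have [|Z [Z1 YZ]] := Ycl [set Z | hnorm (ip (scale_metric r g)) (Y - Z) < e].
  by exists e.
exists (complex_scale c%:C Z); split.
  by rewrite /unit_ball /= (D_norm_rescale _ c0 ccs nabla_rs).
by apply: eB; rewrite /= -[_ - _]scalerBr [hnorm _ _](hnorm_rescale _ ccs).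
Qed.

Lemma D_minkowski_rescale r s c nabla_r nabla_s X : c != 0 -> c * c * s = r ->
  (forall delta X, derivation alpha delta -> smooth_rv alpha X ->
    nabla_s delta X = nabla_r delta X) ->
  (forall delta d X, derivation alpha delta -> smooth_rv alpha X ->
    nabla_s delta (complex_scale d X) = complex_scale d (nabla_s delta X)) ->
  D_minkowski alpha N tau (scale_metric s g) nabla_s (complex_scale c%:C X) =
  D_minkowski alpha N tau (scale_metric r g) nabla_r X.
Proof.
move=> c0 ccs nabla_sr nablaZ; apply/eqP; rewrite eq_le; apply/andP; split.
  apply: D_minkowski_rescale_le => // delta Y dd sY.
  by rewrite nablaZ// nabla_sr.
rewrite -[X in (D_minkowski _ _ _ _ _ X <= _)%E](complex_scaleVK X c0).
apply: D_minkowski_rescale_le; first by rewrite invr_eq0.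
  by rewrite -ccs; field.
move=> delta Y dd sY.
rewrite -nabla_sr//; last exact: smooth_complex_scale.
exact: nablaZ.
Qed.

End Rescaling.

Theorem theorem5p1 (R : realType) (n : nat) (n_gt0 : (0 < n)%N)
  (Theta : 'M[R]_n) (Theta_skew : Theta^T = - Theta)
  (N : 'rV[R]_n -> R) (N_norm : is_norm N)
  (A : cstarType R) (u : 'I_n -> A) (A_torus : is_quantum_torus Theta u)
  (alpha : 'rV[R]_n -> {lrmorphism A -> A})
  (alpha_action : is_torus_action u alpha)
  (tau : A -> R[i]) (tau_state : state tau) (tau_tracial : tracial tau)
  (tau_faithful : faithful tau)
  (Theta_transcendental : generically_transcendental alpha tau)
  (g : 'M[A]_n) (g_riemannian : riemannian alpha g)
  (r s : R) (r_gt0 : 0 < r) (s_gt0 : 0 < s)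
  (nabla_r nabla_s : (A -> A) -> 'rV[A]_n -> 'rV[A]_n)
  (nabla_r_lc : levi_civita alpha tau (scale_metric r g) nabla_r)
  (nabla_s_lc : levi_civita alpha tau (scale_metric s g) nabla_s)
  (Omega_r_mqvb : is_mqvb (torus_triple R)
    (torus_bundle alpha N tau (scale_metric r g) nabla_r))
  (Omega_s_mqvb : is_mqvb (torus_triple R)
    (torus_bundle alpha N tau (scale_metric s g) nabla_s)) :
  propinquity (torus_triple R)
    (torus_bundle alpha N tau (scale_metric r g) nabla_r)
    (torus_bundle alpha N tau (scale_metric s g) nabla_s) = 0%E.
Proof.
have lc_s : levi_civita alpha tau g nabla_s.
  by apply: (levi_civita_unscale alpha_action _ g_riemannian nabla_s_lc);
    rewrite gt_eqF.
have lc_r : levi_civita alpha tau g nabla_r.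
  by apply: (levi_civita_unscale alpha_action _ g_riemannian nabla_r_lc);
    rewrite gt_eqF.
have nabla_sr := levi_civita_unique A_torus alpha_action g_riemannian lc_s lc_r
  Theta_transcendental.
(* The inner product is sesquilinear, so a vector absorbs only the square root of
   the ratio of the metrics. *)
pose c := Num.sqrt (r / s).
have c0 : c != 0 by rewrite gt_eqF// sqrtr_gt0 divr_gt0.
have ccs : c * c * s = r.
  by rewrite -expr2 sqr_sqrtr ?divr_ge0 ?ltW// divfK// gt_eqF.
apply: (propinquity_isometry (Phi := complex_scale c%:C) _ Omega_r_mqvb
  Omega_s_mqvb).
- by exists tau.
- by move=> X Y; rewrite ip_complex_scale !ip_scale_metric scalerA -rmorphM ccs.
- move=> X; apply: D_minkowski_rescale => // delta d Y dd sY.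
  exact: (connectionZ _ nabla_s_lc).
- move=> Y; exists (complex_scale c^-1%:C Y).
  by rewrite complex_scaleA mulrC -complex_scaleA complex_scaleVK.
Qed.
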